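(* Suppose that $f(z)=h(z)+\overline{g(z)}=\sum_{k=0}^\infty a_k z^k+\overline{\sum_{k=1}^\infty b_k z^k}$ is a harmonic mapping in the unit disk $\mathbb{D}=\{z\in\mathbb{C}:|z|<1\}$, where $h$ and $g$ are analytic in $\mathbb{D}$, $\|h\|_\infty=1$ and $|g'(z)|\le |h'(z)|$ for all $z\in\mathbb{D}$. Then $$|a_0|+\sum_{k=1}^{\infty}\big(|a_k|+|b_k|\big)r^k+\frac38\sum_{k=1}^{\infty}\big(|a_k|^2+|b_k|^2\big)r^k\le 1\quad\text{for } r\le\frac15.$$ The constants $3/8$ and $1/5$ cannot be improved.
   Context: Here $0\le r<1$ and $\|h\|_\infty=\sup_{z\in\mathbb{D}}|h(z)|$. ''A constant cannot be improved'' means that if that constant (the coefficient $3/8$, respectively the upper bound $1/5$ on $r$) is replaced by any larger number, the other being kept, then the resulting inequality fails for some $f$ satisfying the hypotheses and some $r$ in the corresponding range. *)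

(* Defs.v *)
From Stdlib Require Export Reals.
From Coquelicot Require Export Coquelicot.

Open Scope R_scope.

Definition in_disk (z : C) : Prop := Cmod z < 1.

Definition analytic_in_disk (h : C -> C) : Prop :=
  forall z : C, in_disk z -> ex_derive h z.

Definition sup_norm (h : C -> C) : Rbar :=
  Lub_Rbar (fun x : R => exists z : C, in_disk z /\ x = Cmod (h z)).

(** The sequence [b] is indexed from [0] with [b 0 = 0], so that
    [g z] is the sum of [b k * z ^ k] over [k >= 1].  "Harmonic mapping" means
    complex-valued harmonic function: univalence is not required, and
    harmonicity of [f] is a consequence of the decomposition.  [C_derive] is
    the complex derivative because [h] and [g] are analytic. *)
Record harmonic_mapping (f h g : C -> C) (a b : nat -> C) : Prop := {
  hm_decomposition : forall z : C, in_disk z -> f z = Cplus (h z) (Cconj (g z));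
  hm_analytic_h : analytic_in_disk h;
  hm_analytic_g : analytic_in_disk g;
  hm_series_h : forall z : C, in_disk z -> is_pseries a z (h z);
  hm_series_g : forall z : C, in_disk z -> is_pseries b z (g z);
  hm_b0 : b 0%nat = RtoC 0;
  hm_norm_h : sup_norm h = Finite 1;
  hm_dilatation :
    forall z : C, in_disk z -> Cmod (C_derive g z) <= Cmod (C_derive h z)
}.

Definition linear_term (a b : nat -> C) (r : R) (k : nat) : R :=
  (Cmod (a k) + Cmod (b k)) * r ^ k.

Definition quadratic_term (a b : nat -> C) (r : R) (k : nat) : R :=
  (Cmod (a k) ^ 2 + Cmod (b k) ^ 2) * r ^ k.

(** [Series] is a total operator, so convergence has to be asserted
    separately.  The shift [S k] makes the sums start at [1]. *)
Definition bohr_series_converge (a b : nat -> C) (r : R) : Prop :=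
  ex_series (fun k : nat => linear_term a b r (S k)) /\
  ex_series (fun k : nat => quadratic_term a b r (S k)).

Definition bohr_sum (c : R) (a b : nat -> C) (r : R) : R :=
  Cmod (a 0%nat)
  + Series (fun k : nat => linear_term a b r (S k))
  + c * Series (fun k : nat => quadratic_term a b r (S k)).

(* Main.v *)
Require Import Defs.
From Stdlib Require Import Reals Lra Lia Psatz.
From Coquelicot Require Import Coquelicot.
Open Scope R_scope.

(** The series of [h] and [g] are compared through mean squares. If one function is
dominated by another on the disk, then on every circle its mean square is not larger
([coefficients_sqr_le_of_Cmod_le]).

Applied to [h * (1 + c * z ^ n)] and [1 + c * z ^ n], this bounds the coefficients of a
function with [|h| <= 1]; summed with weights [t ^ n], the bounds give, with
[x = |a_0|],

  sum over [k >= 1] of [|a_k| ^ 2 * t ^ k  <=  t * (1 - x ^ 2) ^ 2 / (1 - x ^ 2 * t)]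

([bounded_energy]). Applied to [z * g'] and [z * h'], and followed by two integrations
in [t], it shows that the [b_k] satisfy the same bound
([coefficients_sqr_le_of_derivative_le]). A weighted Cauchy-Schwarz inequality with
[t = r / x] then yields, for both sequences,

  sum over [k >= 1] of [|a_k| * r ^ k  <=  r * (1 - x ^ 2) / (1 - x * r)]

when [r < x] ([linear_sum_le]). At [r = 1 / 5] the inequality becomes a polynomial
inequality in [x], while for [x <= 1 / 5] crude estimates are enough
([bohr_inequality]).

Apart from the crude estimates, all these bounds are equalities for
[h z = (x - z) / (1 - x * z)] and [g = h - x]. For these mappings the sum is an
explicit function of [x] and [r], and letting [x] tend to 1 shows that neither
constant can be enlarged. *)

(** * Complex power series and their radius of convergence *)

Definition psum (a : nat -> C) (z : C) (n : nat) : C :=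
  sum_n (fun k => (a k * Cpow z k)%C) n.

Lemma psum_O a z : psum a z 0 = a 0%nat.
Proof. unfold psum. rewrite sum_O. simpl. ring. Qed.

Lemma psum_S a z n : psum a z (S n) = (psum a z n + a (S n) * Cpow z (S n))%C.
Proof. unfold psum. rewrite sum_Sn. reflexivity. Qed.

Lemma pow_n_Cpow (z : C) n : pow_n (K := C_Ring) z n = Cpow z n.
Proof. induction n as [|n IH]; simpl; [reflexivity|]. now rewrite IH. Qed.

Lemma sum_n_le (u v : nat -> R) n :
  (forall k, (k <= n)%nat -> u k <= v k) -> sum_n u n <= sum_n v n.
Proof.
  induction n as [|n IH]; intros H.
  - rewrite !sum_O. apply H; lia.
  - rewrite !sum_Sn. apply Rplus_le_compat; [apply IH; intros; apply H; lia|apply H; lia].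
Qed.

Lemma is_series_Cmod (u : nat -> C) (l : C) :
  is_series u l <-> is_lim_seq (fun n => Cmod (sum_n u n - l)) 0.
Proof.
  unfold is_series. split; intros H.
  - apply is_lim_seq_spec. intros eps.
    assert (H1 := H _ (locally_ball_norm (V := C_NormedModule) l eps)).
    destruct H1 as [N HN]. exists N. intros n Hn. specialize (HN n Hn).
    unfold ball_norm in HN. rewrite Rminus_0_r, Rabs_pos_eq; [exact HN|apply Cmod_ge_0].
  - intros P HP.
    destruct (locally_norm_le_locally (V := C_NormedModule) l P HP) as [eps He].
    apply is_lim_seq_spec in H. destruct (H eps) as [N HN]. exists N. intros n Hn.
    apply He. specialize (HN n Hn). rewrite Rminus_0_r, Rabs_pos_eq in HN; [exact HN|apply Cmod_ge_0].
Qed.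

Lemma is_pseries_Cmod (a : nat -> C) (z l : C) :
  is_pseries a z l <-> is_lim_seq (fun n => Cmod (psum a z n - l)) 0.
Proof.
  unfold is_pseries. eapply iff_trans; [apply is_series_Cmod|].
  assert (E : forall n, sum_n (fun k => scal (pow_n z k) (a k)) n = psum a z n).
  { intros n. apply sum_n_ext. intros k.
    change (pow_n (K := C_Ring) z k * a k = a k * Cpow z k)%C.
    rewrite pow_n_Cpow. ring. }
  split; apply is_lim_seq_ext; intros n; now rewrite E.
Qed.

Lemma is_pseries_psum_bounded (a : nat -> C) (z l : C) :
  is_pseries a z l -> exists M, forall n, Cmod (psum a z n) <= M.
Proof.
  intros H. apply is_pseries_Cmod in H.
  destruct (filterlim_bounded _ (ex_intro _ 0 H)) as [M HM].
  exists (M + Cmod l). intros n. specialize (HM n).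
  replace (psum a z n) with (psum a z n - l + l)%C by ring.
  eapply Rle_trans; [apply Cmod_triangle|]. apply Rplus_le_compat_r.
  eapply Rle_trans; [|exact HM]. apply Rle_abs.
Qed.

Lemma is_pseries_term_bounded (a : nat -> C) (z l : C) :
  is_pseries a z l -> exists M, forall n, Cmod (a n) * Cmod z ^ n <= M.
Proof.
  intros H. destruct (is_pseries_psum_bounded a z l H) as [M HM].
  exists (M + M). intros n. rewrite <- Cmod_pow, <- Cmod_mult.
  assert (HM0 := HM 0%nat). assert (H0 := Cmod_ge_0 (psum a z 0)).
  destruct n as [|n].
  - rewrite psum_O in *. simpl. replace (a 0%nat * 1)%C with (a 0%nat) by ring. lra.
  - replace (a (S n) * z ^ S n)%C with (psum a z (S n) + - psum a z n)%C
      by (rewrite psum_S; ring).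
    eapply Rle_trans; [apply Cmod_triangle|]. rewrite Cmod_opp.
    apply Rplus_le_compat; apply HM.
Qed.

(** Every series below converges in the whole unit disk. Recording this as a
lower bound on the radius of the series of moduli makes it stable under squaring
the coefficients and under multiplying them by the index. *)
Lemma radius_ge_1 (u : nat -> R) :
  (forall s, 0 <= s < 1 -> exists M, forall n, Rabs (u n) * s ^ n <= M) ->
  Rbar_le 1 (CV_radius u).
Proof.
  intros H. apply Rbar_not_lt_le. intros Hlt.
  assert (H0 := CV_radius_ge_0 u).
  destruct (CV_radius_bounded u) as [Hub _].
  destruct (CV_radius u) as [c| |]; simpl in *; try tauto.
  assert (Hs : 0 <= (c + 1) / 2 < 1) by lra.
  destruct (H _ Hs) as [M HM].
  assert (Hc : Rbar_le ((c + 1) / 2) c).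
  { apply Hub. exists M. intros n. rewrite Rabs_mult.
    rewrite (Rabs_pos_eq (_ ^ n)); [apply HM|]. apply pow_le; lra. }
  simpl in Hc. lra.
Qed.

Lemma radius_ge_1_inside (u : nat -> R) s :
  Rbar_le 1 (CV_radius u) -> 0 <= s < 1 -> Rbar_lt (Rabs s) (CV_radius u).
Proof.
  intros H Hs. eapply Rbar_lt_le_trans; [|exact H]. simpl. rewrite Rabs_pos_eq; lra.
Qed.

Lemma radius_ge_1_ex_series (u : nat -> R) s :
  Rbar_le 1 (CV_radius u) -> 0 <= s < 1 -> ex_series (fun k => u k * s ^ k).
Proof.
  intros H Hs. apply ex_series_Rabs. apply CV_disk_inside. now apply radius_ge_1_inside.
Qed.

Lemma radius_ge_1_bounded (u : nat -> R) s :
  Rbar_le 1 (CV_radius u) -> 0 <= s < 1 -> exists M, forall n, Rabs (u n) * s ^ n <= M.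
Proof.
  intros H Hs. assert (E := radius_ge_1_ex_series u s H Hs).
  assert (L := ex_series_lim_0 _ E).
  destruct (filterlim_bounded _ (ex_intro _ 0 L)) as [M HM]. exists M. intros n.
  specialize (HM n). change (Rabs (u n * s ^ n) <= M) in HM.
  rewrite Rabs_mult, (Rabs_pos_eq (s ^ n)) in HM; [exact HM|apply pow_le; lra].
Qed.

(** If [u n * s ^ n] is bounded with [s] the square root of [t], so is [u n ^ 2 * t ^ n]. *)
Lemma radius_ge_1_square (u : nat -> R) :
  Rbar_le 1 (CV_radius u) -> Rbar_le 1 (CV_radius (fun k => u k ^ 2)).
Proof.
  intros H. apply radius_ge_1. intros s Hs.
  assert (Hq : 0 <= sqrt s < 1).
  { split; [apply sqrt_pos|]. rewrite <- sqrt_1. apply sqrt_lt_1; lra. }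
  destruct (radius_ge_1_bounded u (sqrt s) H Hq) as [M HM]. exists (M ^ 2). intros n.
  replace (Rabs (u n ^ 2) * s ^ n) with ((Rabs (u n) * sqrt s ^ n) ^ 2).
  - apply pow_incr. split; [|apply HM].
    apply Rmult_le_pos; [apply Rabs_pos|apply pow_le; lra].
  - rewrite Rpow_mult_distr, <- RPow_abs. f_equal.
    rewrite <- pow_mult, Nat.mul_comm, pow_mult. f_equal. apply pow2_sqrt. lra.
Qed.

(** Multiplying by the index is differentiating and then shifting, and neither moves the radius. *)
Lemma radius_INR_mul (u : nat -> R) :
  CV_radius (fun k => INR k * u k) = CV_radius u.
Proof.
  transitivity (CV_radius (PS_incr_1 (PS_derive u))).
  - apply CV_radius_ext. intros [|n]; [apply Rmult_0_l|reflexivity].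
  - rewrite CV_radius_incr_1. apply CV_radius_derive.
Qed.

Lemma pseries_disk_radius (a : nat -> C) (f : C -> C) :
  (forall z, in_disk z -> is_pseries a z (f z)) ->
  Rbar_le 1 (CV_radius (fun k => Cmod (a k))).
Proof.
  intros H. apply radius_ge_1. intros s Hs.
  assert (Hd : Cmod (RtoC s) = s) by (rewrite Cmod_R; apply Rabs_pos_eq; lra).
  destruct (is_pseries_term_bounded a s (f s)) as [M HM].
  { apply H. unfold in_disk. lra. }
  exists M. intros n. rewrite Rabs_pos_eq by apply Cmod_ge_0. rewrite <- Hd at 1. apply HM.
Qed.

(** [sum_n] and the series operators leave the ring operations behind canonical
structures that [ring] does not recognize; these two tactics fold them back. *)
Ltac ring_C :=
  change (mult (K := C_Ring)) with Cmult; change (plus (G := C_AbelianMonoid)) with Cplus;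
  match goal with |- @eq _ ?x ?y => change (@eq C x y) end; ring.

Ltac ring_R :=
  change (plus (G := R_AbelianMonoid)) with Rplus;
  match goal with |- @eq _ ?x ?y => change (@eq R x y) end; ring.

Lemma sum_n_Cmult_l (c : C) (u : nat -> C) n :
  sum_n (fun k => (c * u k)%C) n = (c * sum_n u n)%C.
Proof. exact (sum_n_mult_l (K := C_Ring) c u n). Qed.

(** * Discrete Parseval identity *)

Definition cis (t : R) : C := (cos t, sin t).

Lemma cis_add x y : cis (x + y) = (cis x * cis y)%C.
Proof.
  unfold cis, Cmult; simpl. rewrite cos_plus, sin_plus. f_equal; ring.
Qed.

Lemma cis_0 : cis 0 = 1.
Proof. unfold cis. rewrite cos_0, sin_0. reflexivity. Qed.

Lemma cis_pow t n : Cpow (cis t) n = cis (INR n * t).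
Proof.
  induction n as [|n IH].
  - simpl. rewrite Rmult_0_l, cis_0. reflexivity.
  - rewrite Cpow_S, IH, <- cis_add. f_equal. rewrite S_INR. ring.
Qed.

Lemma cis_conj t : Cconj (cis t) = cis (- t).
Proof. unfold cis, Cconj; simpl. now rewrite cos_neg, sin_neg. Qed.

Lemma Cmod_cis t : Cmod (cis t) = 1.
Proof.
  unfold Cmod, cis. cbn [fst snd].
  replace (cos t ^ 2 + sin t ^ 2) with 1; [apply sqrt_1|].
  rewrite <- (sin2_cos2 t). unfold Rsqr. ring.
Qed.

Lemma cis_full_turns n : cis (2 * INR n * PI) = 1.
Proof.
  rewrite <- cis_0. unfold cis.
  replace (2 * INR n * PI) with (0 + 2 * INR n * PI) by ring.
  now rewrite cos_period, sin_period.
Qed.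

Lemma cis_neq_1 t : 0 < t < 2 * PI -> cis t <> 1.
Proof.
  intros Ht E. assert (Hc : cos t = 1) by (injection E; auto).
  replace t with (2 * (t / 2)) in Hc by field.
  rewrite cos_2a_sin in Hc. assert (0 < sin (t / 2)) by (apply sin_gt_0; lra). nra.
Qed.

Lemma geometric_sum_C (w : C) n :
  ((w - 1) * sum_n (fun j => Cpow w j) n = Cpow w (S n) - 1)%C.
Proof.
  induction n as [|n IH].
  - rewrite sum_O. simpl. ring.
  - rewrite sum_Sn. change plus with Cplus.
    rewrite Cmult_plus_distr_l, IH, (Cpow_S w (S n)). ring.
Qed.

Definition circle_point (s : R) (N j : nat) : C :=
  (RtoC s * cis (INR j * (2 * PI / INR N)))%C.

Lemma Cmod_circle_point s N j : 0 <= s -> Cmod (circle_point s N j) = s.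
Proof.
  intros Hs. unfold circle_point. rewrite Cmod_mult, Cmod_cis, Cmod_R, Rabs_pos_eq; lra.
Qed.

(** The sum is geometric, with ratio an [N]-th root of unity other than 1, where
[N = p + 1]. *)
Lemma circle_point_orthogonal s p k m :
  (k < m <= p)%nat ->
  sum_n (fun j => (Cpow (circle_point s (S p) j) k
                   * Cconj (Cpow (circle_point s (S p) j) m))%C) p = RtoC 0.
Proof.
  intros H. set (t := 2 * PI / INR (S p)).
  assert (HN : 0 < INR (S p)) by (apply lt_0_INR; lia).
  set (w := cis (- (INR (m - k) * t))).
  rewrite (sum_n_ext _ (fun j => (RtoC (s ^ (k + m)) * Cpow w j)%C)).
  2:{ intros j. unfold circle_point, w. rewrite !Cpow_mult_l, Cmult_conj, !cis_pow, cis_conj.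
      rewrite <- !RtoC_pow.
      change (mult (K := C_Ring)) with Cmult.
      replace (Cconj (RtoC (s ^ m))) with (RtoC (s ^ m))
        by (unfold Cconj, RtoC; simpl; f_equal; ring).
      rewrite pow_add, RtoC_mult. fold t.
      replace (INR j * - (INR (m - k) * t)) with (INR k * (INR j * t) + - (INR m * (INR j * t)))
        by (rewrite minus_INR by lia; ring).
      rewrite cis_add. ring_C. }
  rewrite sum_n_Cmult_l.
  enough (E : sum_n (fun j => Cpow w j) p = RtoC 0).
  { transitivity (RtoC (s ^ (k + m)) * 0)%C; [now f_equal|ring_C]. }
  assert (G := geometric_sum_C w p).
  assert (Ht : INR (S p) * t = 2 * PI) by (unfold t; field; lra).
  assert (Hmk : 0 < INR (m - k)) by (apply lt_0_INR; lia).
  assert (HmN : INR (m - k) < INR (S p)) by (apply lt_INR; lia).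
  assert (Hpi := PI_RGT_0).
  assert (Htp : 0 < t) by (unfold t; apply Rdiv_lt_0_compat; lra).
  assert (Hw : Cpow w (S p) = 1).
  { unfold w. rewrite cis_pow.
    replace (INR (S p) * - (INR (m - k) * t)) with (- (2 * INR (m - k) * PI)) by nra.
    rewrite <- cis_conj, cis_full_turns. unfold Cconj, RtoC; simpl. f_equal; ring. }
  rewrite Hw in G. replace (RtoC 1 - RtoC 1)%C with (RtoC 0) in G by ring.
  destruct (Ceq_dec (sum_n (fun j => Cpow w j) p) (RtoC 0)) as [|Hs]; [assumption|].
  exfalso. apply (Cmult_neq_0 (w - 1) _) in Hs; [now apply Hs|].
  intros E. apply (cis_neq_1 (INR (m - k) * t)).
  - split; nra.
  - assert (Ew : w = 1) by (replace w with (w - 1 + 1)%C by ring; rewrite E; ring).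
    unfold w in Ew. rewrite <- cis_conj in Ew.
    rewrite <- (Cconj_conj (cis (INR (m - k) * t))), Ew.
    unfold Cconj, RtoC; simpl. f_equal; ring.
Qed.

Lemma psum_orthogonal (q : nat -> C) s p M m :
  (M < m <= p)%nat ->
  sum_n (fun j => (psum q (circle_point s (S p) j) M
                   * Cconj (Cpow (circle_point s (S p) j) m))%C) p = RtoC 0.
Proof.
  intros H. induction M as [|M IH].
  - rewrite (sum_n_ext _ (fun j => (q 0%nat * (Cpow (circle_point s (S p) j) 0
                   * Cconj (Cpow (circle_point s (S p) j) m)))%C)).
    2:{ intros j. rewrite psum_O. simpl. ring_C. }
    rewrite sum_n_Cmult_l, circle_point_orthogonal by lia.
    ring_C.
  - rewrite (sum_n_ext _ (fun j => plus (psum q (circle_point s (S p) j) M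
                   * Cconj (Cpow (circle_point s (S p) j) m))%C
        (q (S M) * (Cpow (circle_point s (S p) j) (S M)
                   * Cconj (Cpow (circle_point s (S p) j) m)))%C)).
    2:{ intros j. rewrite psum_S. ring_C. }
    rewrite sum_n_plus, sum_n_Cmult_l, IH, circle_point_orthogonal by lia.
    ring_C.
Qed.

Lemma Cmod_plus_sqr (x y : C) :
  Cmod (x + y) ^ 2 = Cmod x ^ 2 + Cmod y ^ 2 + 2 * Re (x * Cconj y).
Proof.
  unfold Cmod. rewrite !pow2_sqrt by (apply Rplus_le_le_0_compat; apply pow2_ge_0).
  destruct x, y; simpl. ring.
Qed.

Lemma Re_sum_n (u : nat -> C) n : Re (sum_n u n) = sum_n (fun k => Re (u k)) n.
Proof.
  induction n as [|n IH]; [now rewrite !sum_O|]. rewrite !sum_Sn, <- IH. reflexivity.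
Qed.

(** For a polynomial of degree less than [N], averaging over [N] equidistant
points of the circle gives the exact [L^2] norm, so no integral is needed. *)
Lemma discrete_parseval (q : nat -> C) s p M :
  0 <= s -> (M <= p)%nat ->
  sum_n (fun j => Cmod (psum q (circle_point s (S p) j) M) ^ 2) p
  = INR (S p) * sum_n (fun k => Cmod (q k) ^ 2 * (s ^ 2) ^ k) M.
Proof.
  intros Hs H. induction M as [|M IH].
  - rewrite (sum_n_ext _ (fun _ => Cmod (q 0%nat) ^ 2)) by (intros j; now rewrite psum_O).
    rewrite sum_n_const, sum_O. simpl. ring.
  - set (z := circle_point s (S p)) in *.
    rewrite (sum_n_ext _ (fun j => plus (plus (Cmod (psum q (z j) M) ^ 2)
        (Cmod (q (S M)) ^ 2 * (s ^ 2) ^ S M))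
        (2 * Re (Cconj (q (S M)) * (psum q (z j) M * Cconj (Cpow (z j) (S M))))%C))).
    2:{ intros j. rewrite psum_S, Cmod_plus_sqr, Cmod_mult, Cmod_pow.
        unfold z at 2. rewrite Cmod_circle_point by assumption.
        rewrite Cmult_conj. change (mult (K := C_Ring)) with Cmult. change plus with Rplus.
        f_equal.
        - f_equal. rewrite Rpow_mult_distr, <- !pow_mult. do 2 f_equal. lia.
        - f_equal. f_equal. ring. }
    rewrite !sum_n_plus, IH, sum_n_const, sum_Sn by lia.
    change plus with Rplus.
    rewrite (sum_n_mult_l (K := R_Ring) 2), <- Re_sum_n, sum_n_Cmult_l.
    unfold z. rewrite psum_orthogonal by lia.
    change (mult (K := C_Ring)) with Cmult. change (mult (K := R_Ring)) with Rmult.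
    rewrite Cmult_0_r. simpl Re. ring_R.
Qed.

(** * From pointwise to mean-square domination *)

Lemma Cmod_psum_le (a : nat -> C) (z : C) n :
  Cmod (psum a z n) <= sum_n (fun k => Cmod (a k) * Cmod z ^ k) n.
Proof.
  induction n as [|n IH].
  - rewrite psum_O, sum_O. simpl. lra.
  - rewrite psum_S, sum_Sn. eapply Rle_trans; [apply Cmod_triangle|].
    rewrite Cmod_mult, Cmod_pow. apply Rplus_le_compat_r, IH.
Qed.

Lemma psum_tail_le (a : nat -> C) (z : C) n m :
  (n <= m)%nat ->
  Cmod (psum a z m - psum a z n)
  <= sum_n (fun k => Cmod (a k) * Cmod z ^ k) m - sum_n (fun k => Cmod (a k) * Cmod z ^ k) n.
Proof.
  intros H. induction H as [|m H IH].
  - replace (psum a z n - psum a z n)%C with (RtoC 0) by ring. rewrite Cmod_0. lra.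
  - rewrite psum_S, sum_Sn. change plus with Rplus.
    replace (psum a z m + a (S m) * z ^ S m - psum a z n)%C
      with ((psum a z m - psum a z n) + a (S m) * z ^ S m)%C by ring.
    eapply Rle_trans; [apply Cmod_triangle|]. rewrite Cmod_mult, Cmod_pow. lra.
Qed.

Lemma sum_n_le_Series (u : nat -> R) n :
  (forall k, 0 <= u k) -> ex_series u -> sum_n u n <= Series u.
Proof.
  intros Hu Hex. apply Series_correct in Hex.
  apply (is_lim_seq_incr_compare (sum_n u) (Series u)); [exact Hex|].
  intros k. rewrite sum_Sn. change plus with Rplus. specialize (Hu (S k)). lra.
Qed.

Lemma pseries_remainder_le (a : nat -> C) (z l : C) n :
  is_pseries a z l -> ex_series (fun k => Cmod (a k) * Cmod z ^ k) ->
  Cmod (l - psum a z n)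
  <= Series (fun k => Cmod (a k) * Cmod z ^ k) - sum_n (fun k => Cmod (a k) * Cmod z ^ k) n.
Proof.
  intros Hl Hex. apply is_pseries_Cmod in Hl.
  set (w := fun k => Cmod (a k) * Cmod z ^ k) in *.
  assert (L : is_lim_seq (fun m => Cmod (psum a z (m + n) - l) + (Series w - sum_n w n))
                         (0 + (Series w - sum_n w n))).
  { apply is_lim_seq_plus'; [|apply is_lim_seq_const].
    now apply is_lim_seq_incr_n with (u := fun m => Cmod (psum a z m - l)). }
  rewrite Rplus_0_l in L.
  refine (is_lim_seq_le _ _ _ _ _ (is_lim_seq_const _) L). intros m. simpl.
  replace (l - psum a z n)%C with (- (psum a z (m + n) - l) + (psum a z (m + n) - psum a z n))%C by ring.
  eapply Rle_trans; [apply Cmod_triangle|]. rewrite Cmod_opp. apply Rplus_le_compat_l.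
  eapply Rle_trans; [apply psum_tail_le; lia|]. fold w.
  apply Rplus_le_compat_r, sum_n_le_Series; [|assumption].
  intros k. apply Rmult_le_pos; [apply Cmod_ge_0|apply pow_le, Cmod_ge_0].
Qed.

(** Both sides are mean squares over the circle of radius [s]. Truncating the two
series at degree [m] perturbs the pointwise inequality by an error [e m] that is
uniform on the circle and tends to 0, and for the truncations the mean squares
are computed by the discrete Parseval identity. *)
Lemma coefficients_sqr_le_of_Cmod_le (u v : nat -> C) (U V : C -> C) :
  (forall z, in_disk z -> is_pseries u z (U z)) ->
  (forall z, in_disk z -> is_pseries v z (V z)) ->
  (forall z, in_disk z -> Cmod (U z) <= Cmod (V z)) ->
  forall s n, 0 <= s < 1 ->
  sum_n (fun k => Cmod (u k) ^ 2 * (s ^ 2) ^ k) n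
  <= Series (fun k => Cmod (v k) ^ 2 * (s ^ 2) ^ k).
Proof.
  intros HU HV Hle s n Hs.
  assert (Ru := pseries_disk_radius u U HU).
  assert (Rv := pseries_disk_radius v V HV).
  assert (Eu := radius_ge_1_ex_series _ s Ru Hs).
  assert (Ev := radius_ge_1_ex_series _ s Rv Hs).
  assert (Es : ex_series (fun k => Cmod (v k) ^ 2 * (s ^ 2) ^ k)).
  { apply (radius_ge_1_ex_series (fun k => Cmod (v k) ^ 2)); [now apply radius_ge_1_square|nra]. }
  set (wu := fun k => Cmod (u k) * s ^ k) in *.
  set (wv := fun k => Cmod (v k) * s ^ k) in *.
  set (B := Series wv).
  (* The two remainders together; each is bounded by the tail of the series of moduli. *)
  set (e := fun m => (Series wu - sum_n wu m) + (Series wv - sum_n wv m)).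
  assert (wu0 : forall k, 0 <= wu k)
    by (intros k; apply Rmult_le_pos; [apply Cmod_ge_0|apply pow_le; lra]).
  assert (wv0 : forall k, 0 <= wv k)
    by (intros k; apply Rmult_le_pos; [apply Cmod_ge_0|apply pow_le; lra]).
  assert (He0 : forall m, 0 <= e m).
  { intros m. unfold e. assert (H1 := sum_n_le_Series wu m wu0 Eu).
    assert (H2 := sum_n_le_Series wv m wv0 Ev). lra. }
  assert (He : is_lim_seq e 0).
  { unfold e. replace (Finite 0) with (Finite ((Series wu - Series wu) + (Series wv - Series wv)))
      by (f_equal; ring).
    apply is_lim_seq_plus'; apply is_lim_seq_minus';
      try apply is_lim_seq_const; now apply Series_correct. }
  assert (Hpt : forall m z, Cmod z = s ->
     Cmod (psum u z m) ^ 2 <= Cmod (psum v z m) ^ 2 + (2 * B + e m) * e m).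
  { intros m z Hz. assert (Dz : in_disk z) by (unfold in_disk; lra).
    assert (T1 := pseries_remainder_le u z (U z) m (HU z Dz)).
    assert (T2 := pseries_remainder_le v z (V z) m (HV z Dz)).
    assert (T3 := Cmod_psum_le v z m). rewrite Hz in T1, T2, T3. fold wu wv in T1, T2, T3.
    specialize (T1 Eu). specialize (T2 Ev).
    assert (T4 := sum_n_le_Series wv m wv0 Ev). fold B in T4.
    assert (T : Cmod (psum u z m) <= Cmod (psum v z m) + e m).
    { replace (psum u z m) with (- (U z - psum u z m) + U z)%C by ring.
      eapply Rle_trans; [apply Cmod_triangle|]. rewrite Cmod_opp.
      assert (T5 : Cmod (V z) <= Cmod (psum v z m) + Cmod (V z - psum v z m)).
      { replace (V z) with (psum v z m + (V z - psum v z m))%C at 1 by ring. apply Cmod_triangle. }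
      specialize (Hle z Dz). unfold e. lra. }
    assert (P1 := Cmod_ge_0 (psum u z m)). assert (P2 := Cmod_ge_0 (psum v z m)).
    (* Squaring [|u_m| <= |v_m| + e_m] and using [|v_m| <= B]. *)
    specialize (He0 m). nra. }
  assert (Hm : forall m, sum_n (fun k => Cmod (u k) ^ 2 * (s ^ 2) ^ k) (m + n)
      <= Series (fun k => Cmod (v k) ^ 2 * (s ^ 2) ^ k) + (2 * B + e (m + n)%nat) * e (m + n)%nat).
  { intros m. set (p := (m + n)%nat).
    assert (HN : 0 < INR (S p)) by (apply lt_0_INR; lia).
    apply Rle_trans with (sum_n (fun k => Cmod (v k) ^ 2 * (s ^ 2) ^ k) p + (2 * B + e p) * e p).
    - apply Rmult_le_reg_l with (INR (S p)); [exact HN|].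
      rewrite Rmult_plus_distr_l, <- !discrete_parseval by (lia || lra).
      rewrite <- (sum_n_const p ((2 * B + e p) * e p)).
      change Rplus with (plus (G := R_AbelianMonoid)). rewrite <- (sum_n_plus (G := R_AbelianMonoid)).
      apply sum_n_le. intros j _. apply Hpt, Cmod_circle_point. lra.
    - apply Rplus_le_compat_r. apply sum_n_le_Series; [|exact Es].
      intros k. apply Rmult_le_pos; [apply pow2_ge_0|apply pow_le, pow2_ge_0]. }
  assert (He' : is_lim_seq (fun m => e (m + n)%nat) 0) by now apply is_lim_seq_incr_n.
  assert (L : is_lim_seq (fun m => Series (fun k => Cmod (v k) ^ 2 * (s ^ 2) ^ k)
        + (2 * B + e (m + n)%nat) * e (m + n)%nat)
      (Series (fun k => Cmod (v k) ^ 2 * (s ^ 2) ^ k) + (2 * B + 0) * 0)).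
  { apply is_lim_seq_plus'; [apply is_lim_seq_const|].
    apply is_lim_seq_mult'; [|exact He'].
    apply is_lim_seq_plus'; [apply is_lim_seq_const|exact He']. }
  rewrite Rmult_0_r, Rplus_0_r in L.
  refine (is_lim_seq_le _ _ _ _ _ (is_lim_seq_const _) L). intros m.
  eapply Rle_trans; [|apply Hm].
  clear -Hs. induction m as [|m IH]; [apply Rle_refl|].
  rewrite Nat.add_succ_l, sum_Sn. change plus with Rplus.
  assert (0 <= Cmod (u (S (m + n))) ^ 2 * (s ^ 2) ^ S (m + n))
    by (apply Rmult_le_pos; [apply pow2_ge_0|apply pow_le, pow2_ge_0]). lra.
Qed.

(** * Coefficients of a function bounded by one *)

Lemma sum_n_le_of_radial (x : nat -> R) (L : R) n :
  (forall k, 0 <= x k) ->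
  (forall t, 0 <= t < 1 -> sum_n (fun k => x k * t ^ k) n <= L) ->
  sum_n x n <= L.
Proof.
  intros Hx H. 
  assert (Hlim : is_lim_seq (fun m => sum_n (fun k => x k * (1 - / (INR m + 1)) ^ k) n) (sum_n x n)).
  { assert (H1 : is_lim_seq (fun m => 1 - / (INR m + 1)) 1).
    { replace (Finite 1) with (Finite (1 - 0)) by (f_equal; ring).
      apply is_lim_seq_minus'; [apply is_lim_seq_const|].
      replace (Finite 0) with (Rbar_inv p_infty) by reflexivity.
      apply is_lim_seq_inv; [|discriminate].
      replace p_infty with (Rbar_plus p_infty 1) by reflexivity.
      eapply is_lim_seq_plus; [apply is_lim_seq_INR|apply is_lim_seq_const|reflexivity]. }
    assert (H2 : forall k, is_lim_seq (fun m => x k * (1 - / (INR m + 1)) ^ k) (x k)).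
    { intros k. replace (Finite (x k)) with (Finite (x k * 1)) by (f_equal; ring).
      apply is_lim_seq_mult'; [apply is_lim_seq_const|].
      induction k as [|k IH]; [apply is_lim_seq_const|]. simpl.
      replace (Finite 1) with (Finite (1 * 1)) by (f_equal; ring).
      now apply is_lim_seq_mult'. }
    clear -H2. induction n as [|n IH].
    - rewrite sum_O. eapply is_lim_seq_ext; [|apply (H2 0%nat)]. intros m. now rewrite sum_O.
    - rewrite sum_Sn. eapply is_lim_seq_ext; [intros m; symmetry; apply sum_Sn|].
      apply is_lim_seq_plus'; [exact IH|apply H2]. }
  refine (is_lim_seq_le _ _ _ _ _ Hlim (is_lim_seq_const L)).
  intros m. apply H. assert (Hm := pos_INR m).
  assert (0 < / (INR m + 1)) by (apply Rinv_0_lt_compat; lra).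
  assert (/ (INR m + 1) <= 1).
  { rewrite <- Rinv_1. apply Rinv_le_contravar; lra. }
  lra.
Qed.

Lemma is_series_finite_support (u : nat -> R) n :
  (forall k, (n < k)%nat -> u k = 0) -> is_series u (sum_n u n).
Proof.
  intros H. unfold is_series. apply filterlim_ext_loc with (f := fun _ => sum_n u n).
  - exists n. intros m Hm. induction Hm as [|m Hm IH]; [reflexivity|].
    rewrite sum_Sn, H by lia. rewrite <- IH. symmetry. apply (plus_zero_r (G := R_AbelianMonoid)).
  - apply filterlim_const.
Qed.

(** Coefficients of [(1 + c * z ^ n) * f z] when [a] are those of [f]. *)
Definition one_plus_monomial_mult (c : C) (n : nat) (a : nat -> C) (k : nat) : C :=
  if (k <? n)%nat then a k else (a k + c * a (k - n)%nat)%C.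

Lemma is_pseries_one_plus_monomial_mult (c : C) n (a : nat -> C) (z l : C) :
  is_pseries a z l -> is_pseries (one_plus_monomial_mult c n a) z ((1 + c * Cpow z n) * l)%C.
Proof.
  intros H.
  assert (H1 := is_pseries_scal c _ z _ (Cmult_comm z c) (is_pseries_incr_n a n z l H)).
  assert (H2 := is_pseries_plus _ _ z _ _ H H1).
  replace ((1 + c * z ^ n) * l)%C
    with (plus (l : C_NormedModule) (scal (c : C_AbsRing) (scal (pow_n (K := C_AbsRing) z n) l))).
  - eapply is_pseries_ext; [|exact H2]. intros k. unfold PS_plus, PS_scal, one_plus_monomial_mult.
    rewrite PS_incr_n_simplify.
    destruct (Compare_dec.le_lt_dec n k) as [Hk|Hk].
    + destruct (Nat.ltb_spec k n); [lia|reflexivity].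
    + destruct (Nat.ltb_spec k n); [|lia].
      change (a k + c * 0 = a k)%C. ring.
  - change (l + c * (pow_n (K := C_Ring) z n * l) = (1 + c * z ^ n) * l)%C.
    rewrite pow_n_Cpow. ring.
Qed.

Definition one_coef (k : nat) : C := match k with O => 1 | S _ => 0 end.

Lemma is_pseries_one (z : C) : is_pseries one_coef z (RtoC 1).
Proof.
  apply is_pseries_Cmod. eapply is_lim_seq_ext; [|apply is_lim_seq_const].
  intros n. replace (psum one_coef z n) with (RtoC 1).
  - replace (RtoC 1 - RtoC 1)%C with (RtoC 0) by ring. now rewrite Cmod_0.
  - induction n as [|n IH]; [now rewrite psum_O|]. rewrite psum_S, <- IH. simpl. ring.
Qed.

Section BoundedFunction.

Context (h : C -> C) (a : nat -> C)
  (Hser : forall z, in_disk z -> is_pseries a z (h z))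
  (Hbd : forall z, in_disk z -> Cmod (h z) <= 1).

(** Multiplication by [h] does not increase the mean square; apply this to the
polynomial [1 + c * z ^ (n + 1)], keep only the first [n + 2] coefficients of the
product and let the radius tend to 1. *)
Lemma bounded_contraction (c : C) n :
  sum_n (fun k => Cmod (a k) ^ 2) n + Cmod (a (S n) + c * a 0%nat) ^ 2 <= 1 + Cmod c ^ 2.
Proof.
  set (u := one_plus_monomial_mult c (S n) a). set (v := one_plus_monomial_mult c (S n) one_coef).
  assert (Hcmp := coefficients_sqr_le_of_Cmod_le u v
    (fun z => (1 + c * Cpow z (S n)) * h z)%C (fun z => (1 + c * Cpow z (S n)) * 1)%C
    (fun z Hz => is_pseries_one_plus_monomial_mult c (S n) a z _ (Hser z Hz))
    (fun z _ => is_pseries_one_plus_monomial_mult c (S n) one_coef z _ (is_pseries_one z))).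
  assert (Hle : sum_n (fun k => Cmod (u k) ^ 2) (S n) <= 1 + Cmod c ^ 2).
  { assert (Hsqrt : forall t, 0 <= t < 1 -> exists s, 0 <= s < 1 /\ s ^ 2 = t).
    { intros t Ht. exists (sqrt t). split; [|apply pow2_sqrt; lra].
      split; [apply sqrt_pos|]. rewrite <- sqrt_1. apply sqrt_lt_1; lra. }
    apply sum_n_le_of_radial; [intros k; apply pow2_ge_0|].
    intros t Ht. destruct (Hsqrt t Ht) as [s [Hs <-]].
    eapply Rle_trans; [apply Hcmp; [|exact Hs]|].
    - intros z Hz. rewrite !Cmod_mult, Cmod_1.
      apply Rmult_le_compat_l; [apply Cmod_ge_0|now apply Hbd].
    - clear Ht.
      assert (Hsupp : forall k, (S n < k)%nat -> Cmod (v k) ^ 2 * (s ^ 2) ^ k = 0).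
      {  intros k Hk. unfold v, one_plus_monomial_mult. destruct (Nat.ltb_spec k (S n)); [lia|].
        destruct k as [|k]; [lia|]. replace (S k - S n)%nat with (S (k - S n)) by lia. simpl one_coef.
        replace (0 + c * 0)%C with (RtoC 0) by ring. rewrite Cmod_0. simpl. ring. }
      rewrite (is_series_unique _ _ (is_series_finite_support _ _ Hsupp)).
      rewrite sum_Sn. change plus with Rplus.
      assert (E0 : forall m, (m <= n)%nat -> sum_n (fun k => Cmod (v k) ^ 2 * (s ^ 2) ^ k) m = 1).
      { induction m as [|m IH]; intros Hm.
        - rewrite sum_O. unfold v, one_plus_monomial_mult. simpl. rewrite Cmod_1. ring.
        - rewrite sum_Sn, IH by lia. unfold v, one_plus_monomial_mult.
          destruct (Nat.ltb_spec (S m) (S n)); [|lia]. simpl one_coef. rewrite Cmod_0.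
          change plus with Rplus. simpl. ring. }
      rewrite E0 by lia. apply Rplus_le_compat_l.
      replace (v (S n)) with c.
      + rewrite <- (Rmult_1_r (Cmod c ^ 2)) at 2. apply Rmult_le_compat_l; [apply pow2_ge_0|].
        rewrite <- (pow1 (S n)). apply pow_incr. nra.
      + unfold v, one_plus_monomial_mult. rewrite Nat.ltb_irrefl, Nat.sub_diag. simpl. ring. }
  rewrite sum_Sn in Hle. change plus with Rplus in Hle.
  rewrite (sum_n_ext_loc _ (fun k => Cmod (a k) ^ 2)) in Hle.
  - unfold u at 1, one_plus_monomial_mult in Hle. rewrite Nat.ltb_irrefl, Nat.sub_diag in Hle. exact Hle.
  - intros k Hk. unfold u, one_plus_monomial_mult. destruct (Nat.ltb_spec k (S n)); [reflexivity|lia].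
Qed.

Lemma bounded_sum_sqr_le_1 n : sum_n (fun k => Cmod (a k) ^ 2) n <= 1.
Proof.
  assert (H := bounded_contraction 0 n). rewrite Cmod_0 in H.
  assert (H0 := pow2_ge_0 (Cmod (a (S n) + 0 * a 0%nat))). lra.
Qed.

Lemma bounded_coef0_le_1 : Cmod (a 0%nat) <= 1.
Proof.
  assert (H := bounded_sum_sqr_le_1 0). rewrite sum_O in H.
  assert (H0 := Cmod_ge_0 (a 0%nat)). nra.
Qed.

(** The best choice of [c] in [bounded_contraction] is
[a_(n+1) * conj a_0 / (1 - |a_0|^2)]; this strengthens [|a_(n+1)| <= 1 - |a_0|^2]. *)
Lemma bounded_coefficients n :
  (1 - Cmod (a 0%nat) ^ 2) * sum_n (fun k => Cmod (a k) ^ 2) n + Cmod (a (S n)) ^ 2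
  <= 1 - Cmod (a 0%nat) ^ 2.
Proof.
  set (x := Cmod (a 0%nat)). set (A := sum_n _ n). set (y := Cmod (a (S n))).
  assert (Hx0 := Cmod_ge_0 (a 0%nat)). assert (Hx1 := bounded_coef0_le_1). fold x in Hx0, Hx1.
  destruct (Req_dec x 1) as [E|E].
  (* If [|a_0| = 1], the bound on the sum of squares leaves nothing for the other coefficients. *)
  - assert (H1 := bounded_sum_sqr_le_1 (S n)). rewrite sum_Sn in H1. fold A y in H1.
    change plus with Rplus in H1.
    assert (HA : x ^ 2 <= A).
    { unfold A, x. clear. induction n as [|n IH]; [rewrite sum_O; lra|].
      rewrite sum_Sn. change plus with Rplus. assert (H := pow2_ge_0 (Cmod (a (S n)))). lra. }
    rewrite E in *. nra.
  - assert (D : 0 < 1 - x ^ 2) by nra.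
    set (t := / (1 - x ^ 2)).
    assert (H := bounded_contraction (RtoC t * (a (S n) * Cconj (a 0%nat)))%C n).
    replace (a (S n) + RtoC t * (a (S n) * Cconj (a 0%nat)) * a 0%nat)%C
      with (a (S n) * (1 + RtoC t * (a 0%nat * Cconj (a 0%nat))))%C in H by ring.
    rewrite <- Cmod2_conj, <- RtoC_mult, <- RtoC_plus, !Cmod_mult, Cmod_conj, !Cmod_R in H.
    fold x y A in H. rewrite !Rpow_mult_distr, !pow2_abs in H.
    assert (T : 1 + t * x ^ 2 = t) by (unfold t; field; lra).
    rewrite T in H. assert (T1 : t * (1 - x ^ 2) = 1) by (unfold t; field; lra).
    assert (H2 : A + y ^ 2 * t <= 1).
    { replace (y ^ 2 * t) with (y ^ 2 * t ^ 2 * (1 - x ^ 2)).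
      - nra.
      - transitivity (y ^ 2 * t * (t * (1 - x ^ 2))); [ring|]. rewrite T1. ring. }
    replace (y ^ 2) with (y ^ 2 * t * (1 - x ^ 2)).
    + nra.
    + rewrite Rmult_assoc, T1. ring.
Qed.

(** Weight [bounded_coefficients] at [n] by [(1 - t) * t ^ n] and sum over [n].
Equality holds for the disk automorphisms [(x - z) / (1 - x * z)]. *)
Lemma bounded_energy t :
  0 <= t < 1 ->
  (1 - Cmod (a 0%nat) ^ 2 * t) * Series (fun k => Cmod (a (S k)) ^ 2 * t ^ S k)
  <= t * (1 - Cmod (a 0%nat) ^ 2) ^ 2.
Proof.
  intros Ht. set (x := Cmod (a 0%nat)).
  set (A := fun n => sum_n (fun k => Cmod (a k) ^ 2) n).
  set (P := fun n => sum_n (fun k => Cmod (a k) ^ 2 * t ^ k) n).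
  set (Q := fun n => sum_n (fun k => Cmod (a (S k)) ^ 2 * t ^ k) n).
  assert (Hx0 := Cmod_ge_0 (a 0%nat)). assert (Hx1 := bounded_coef0_le_1). fold x in Hx0, Hx1.
  assert (D : 0 <= 1 - x ^ 2) by nra.
  (* Abel summation of the weighted inequalities, done by induction on the partial sums. *)
  assert (Hfin : forall n, (1 - x ^ 2) * P n + (1 - t) * Q n
                 <= (1 - x ^ 2) * (1 - t ^ S n * (1 - A n))).
  { induction n as [|n IH].
    - assert (H := bounded_coefficients 0). unfold P, Q, A. rewrite !sum_O in *. fold x in H |- *. simpl in *. nra.
    - assert (H := bounded_coefficients (S n)). unfold P, Q, A in *. rewrite !(sum_Sn _ n) in *.
      fold x in H. change plus with Rplus in *.
      assert (Hp : 0 <= t ^ S n * (1 - t)) by (apply Rmult_le_pos; [apply pow_le|]; lra).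
      apply (Rmult_le_compat_l _ _ _ Hp) in H.
      replace (t ^ S (S n)) with (t * t ^ S n) by reflexivity. nra. }
  assert (Hrad := radius_ge_1_square _ (pseries_disk_radius a h Hser)).
  assert (EP : ex_series (fun k => Cmod (a k) ^ 2 * t ^ k))
    by exact (radius_ge_1_ex_series _ t Hrad Ht).
  assert (EE := EP). apply ex_series_incr_1 in EE.
  set (E := Series (fun k => Cmod (a (S k)) ^ 2 * t ^ S k)).
  destruct (Req_dec t 0) as [T0|T0].
  { unfold E. rewrite (Series_ext _ (fun _ => 0)).
    - assert (Z : Series (fun _ => 0) = 0).
      { transitivity (sum_n (fun _ => 0) 0); [|apply sum_O].
        now apply is_series_unique, is_series_finite_support. }
      rewrite Z. nra.
    - intros k. rewrite T0. simpl. ring. }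
  assert (LP : is_lim_seq P (x ^ 2 + E)).
  { assert (H := Series_correct _ EP). rewrite (Series_incr_1 _ EP) in H. fold E x in H.
    replace (x ^ 2 + E) with (x ^ 2 * t ^ 0 + E) by (simpl; ring). exact H. }
  assert (LQ : is_lim_seq Q (/ t * E)).
  { assert (H := Series_correct _ EE).
    apply (is_lim_seq_ext (fun n => / t * sum_n (fun k => Cmod (a (S k)) ^ 2 * t ^ S k) n)).
    - intros n. unfold Q. rewrite <- (sum_n_mult_l (K := R_Ring)). apply sum_n_ext. intros k.
      change (mult (K := R_Ring)) with Rmult. simpl. field. exact T0.
    - apply is_lim_seq_mult'; [apply is_lim_seq_const|exact H]. }
  assert (HL : (1 - x ^ 2) * (x ^ 2 + E) + (1 - t) * (/ t * E) <= 1 - x ^ 2).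
  { assert (L : is_lim_seq (fun n => (1 - x ^ 2) * P n + (1 - t) * Q n)
       ((1 - x ^ 2) * (x ^ 2 + E) + (1 - t) * (/ t * E))).
    { apply is_lim_seq_plus'; apply is_lim_seq_mult'; auto using is_lim_seq_const. }
    refine (is_lim_seq_le _ _ _ _ _ L (is_lim_seq_const _)). intros n.
    eapply Rle_trans; [apply Hfin|].
    assert (H := bounded_sum_sqr_le_1 n). fold (A n) in H.
    (* The boundary term of the summation has a favourable sign, since [A n <= 1]. *)
    assert (H1 : 0 <= t ^ S n * (1 - A n)) by (apply Rmult_le_pos; [apply pow_le|]; lra).
    apply (Rmult_le_compat_l _ _ _ D) in H1. lra. }
  apply (Rmult_le_compat_l t) in HL; [|lra].
  replace (t * ((1 - x ^ 2) * (x ^ 2 + E) + (1 - t) * (/ t * E)))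
    with (t * (1 - x ^ 2) * (x ^ 2 + E) + (1 - t) * E) in HL by (field; exact T0).
  nra.
Qed.

End BoundedFunction.

(** * Domination of the derivative passes to the coefficients *)

Definition derived_coef (a : nat -> C) (k : nat) : C := (RtoC (INR (S k)) * a (S k))%C.

(** The error [E_k] of the first-order expansion of [w ^ k] at [z] satisfies
[E_(k+1) = w * E_k + k * z ^ (k-1) * (w - z) ^ 2]. The factor [rho ^ 2] avoids
negative powers of [rho]. *)
Lemma power_taylor_bound (z w : C) (rho : R) k :
  Cmod z <= rho -> Cmod w <= rho ->
  rho ^ 2 * Cmod (Cpow w (S k) - Cpow z (S k) - RtoC (INR (S k)) * Cpow z k * (w - z))
  <= INR (S k) ^ 2 * rho ^ S k * Cmod (w - z) ^ 2.
Proof.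
  intros Hz Hw. assert (H0 := Cmod_ge_0 z).
  induction k as [|k IH].
  - replace (w ^ 1 - z ^ 1 - RtoC (INR 1) * z ^ 0 * (w - z))%C with (RtoC 0) by (simpl; ring).
    rewrite Cmod_0, Rmult_0_r. apply Rmult_le_pos; [|apply pow2_ge_0].
    apply Rmult_le_pos; [apply pow2_ge_0|apply pow_le; lra].
  - set (E := (w ^ S k - z ^ S k - RtoC (INR (S k)) * z ^ k * (w - z))%C) in *.
    replace (w ^ S (S k) - z ^ S (S k) - RtoC (INR (S (S k))) * z ^ S k * (w - z))%C
      with (w * E + RtoC (INR (S k)) * z ^ k * ((w - z) * (w - z)))%C.
    2:{ unfold E. rewrite (S_INR (S k)), RtoC_plus, !(Cpow_S _ (S k)), !(Cpow_S _ k). ring. }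
    set (d := Cmod (w - z)) in *.
    assert (Hn : 0 <= INR (S k)) by apply pos_INR.
    assert (Hr : 0 <= rho ^ k) by (apply pow_le; lra).
    assert (Hzk : Cmod z ^ k <= rho ^ k) by (apply pow_incr; lra).
    apply Rle_trans with (rho * (rho ^ 2 * Cmod E) + rho ^ 2 * (INR (S k) * rho ^ k * (d * d))).
    + replace (rho * (rho ^ 2 * Cmod E) + rho ^ 2 * (INR (S k) * rho ^ k * (d * d)))
        with (rho ^ 2 * (rho * Cmod E + INR (S k) * rho ^ k * (d * d))) by ring.
      apply Rmult_le_compat_l; [apply pow2_ge_0|].
      eapply Rle_trans; [apply Cmod_triangle|].
      rewrite !Cmod_mult, Cmod_pow, Cmod_R, (Rabs_pos_eq _ Hn). fold d.
      apply Rplus_le_compat.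
      * apply Rmult_le_compat_r; [apply Cmod_ge_0|exact Hw].
      * apply Rmult_le_compat_r; [apply Rle_0_sqr|]. now apply Rmult_le_compat_l.
    + apply (Rmult_le_compat_l rho) in IH; [|lra].
      rewrite (S_INR (S k)). set (m := INR (S k)) in *.
      assert (0 <= rho ^ k * (rho * rho) * (d * d) * (m + 1)).
      { apply Rmult_le_pos; [|lra]. apply Rmult_le_pos; [|apply Rle_0_sqr].
        apply Rmult_le_pos; [exact Hr|apply Rle_0_sqr]. }
      simpl in IH |- *. nra.
Qed.

Lemma psum_taylor_bound (a : nat -> C) (z w : C) (rho : R) n :
  Cmod z <= rho -> Cmod w <= rho ->
  rho ^ 2 * Cmod (psum a w (S n) - psum a z (S n) - psum (derived_coef a) z n * (w - z))
  <= sum_n (fun k => INR k * (INR k * Cmod (a k)) * rho ^ k) (S n) * Cmod (w - z) ^ 2.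
Proof.
  intros Hz Hw. assert (H0 := Cmod_ge_0 z).
  assert (Hstep : forall k, rho ^ 2 * Cmod (a (S k) *
      (w ^ S k - z ^ S k - RtoC (INR (S k)) * z ^ k * (w - z)))
      <= INR (S k) * (INR (S k) * Cmod (a (S k))) * rho ^ S k * Cmod (w - z) ^ 2).
  { intros k. rewrite Cmod_mult. assert (H := power_taylor_bound z w rho k Hz Hw).
    apply (Rmult_le_compat_l _ _ _ (Cmod_ge_0 (a (S k)))) in H. nra. }
  induction n as [|n IH].
  - rewrite !psum_S, !psum_O, sum_Sn, sum_O. change plus with Rplus.
    replace (a 0%nat + a 1%nat * w ^ 1 - (a 0%nat + a 1%nat * z ^ 1) - derived_coef a 0 * (w - z))%C
      with (a 1%nat * (w ^ 1 - z ^ 1 - RtoC (INR 1) * z ^ 0 * (w - z)))%C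
      by (unfold derived_coef; simpl; ring).
    eapply Rle_trans; [apply Hstep|]. simpl. lra.
  - rewrite (psum_S a w (S n)), (psum_S a z (S n)), (psum_S (derived_coef a) z n), (sum_Sn _ (S n)).
    change plus with Rplus.
    replace (psum a w (S n) + a (S (S n)) * w ^ S (S n) - (psum a z (S n) + a (S (S n)) * z ^ S (S n))
        - (psum (derived_coef a) z n + derived_coef a (S n) * z ^ S n) * (w - z))%C
      with ((psum a w (S n) - psum a z (S n) - psum (derived_coef a) z n * (w - z))
        + a (S (S n)) * (w ^ S (S n) - z ^ S (S n) - RtoC (INR (S (S n))) * z ^ S n * (w - z)))%C
      by (unfold derived_coef; ring).
    rewrite Rmult_plus_distr_r.
    eapply Rle_trans; [apply Rmult_le_compat_l; [apply pow2_ge_0|apply Cmod_triangle]|].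
    rewrite Rmult_plus_distr_l. apply Rplus_le_compat; [exact IH|apply Hstep].
Qed.

(** The remainder of the first-order expansion is at most
[K * |w - z| ^ 2 / rho ^ 2], where [K] is the sum of [k ^ 2 * |a_k| * rho ^ k]. *)
Lemma pseries_is_derive (a : nat -> C) (f : C -> C) :
  (forall z, in_disk z -> is_pseries a z (f z)) ->
  forall z, in_disk z ->
  exists l : C, is_pseries (derived_coef a) z l /\ is_derive f z l.
Proof.
  intros Hf z Hz. unfold in_disk in Hz. assert (Hz0 := Cmod_ge_0 z).
  assert (Hrad := pseries_disk_radius a f Hf).
  assert (Hrad1 := Hrad). rewrite <- radius_INR_mul in Hrad1.
  assert (Hrad2 := Hrad1). rewrite <- radius_INR_mul in Hrad2.
  assert (Hl : exists l : C, is_pseries (derived_coef a) z l).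
  { apply (ex_series_le (V := C_CompleteNormedModule) _
      (fun k => INR (S k) * Cmod (a (S k)) * Cmod z ^ k)).
    - intros k. change (Cmod (pow_n (K := C_Ring) z k * derived_coef a k)%C
        <= INR (S k) * Cmod (a (S k)) * Cmod z ^ k).
      rewrite pow_n_Cpow. unfold derived_coef.
      rewrite !Cmod_mult, Cmod_pow, Cmod_R, Rabs_pos_eq by apply pos_INR. lra.
    - apply (radius_ge_1_ex_series (PS_derive (fun k => Cmod (a k)))); [|lra].
      now rewrite CV_radius_derive. }
  destruct Hl as [l Hl]. exists l. split; [exact Hl|].
  (* Any [rho] strictly between [|z|] and 1 leaves room for [w] around [z]. *)
  set (rho := (1 + Cmod z) / 2).
  assert (Hrho : Cmod z < rho < 1) by (unfold rho; lra).
  assert (EK := radius_ge_1_ex_series _ rho Hrad2 ltac:(lra)). cbv beta in EK.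
  set (K := Series (fun k => INR k * (INR k * Cmod (a k)) * rho ^ k)) in *.
  assert (Hterm : forall k, 0 <= INR k * (INR k * Cmod (a k)) * rho ^ k).
  { intros k. assert (P := pos_INR k). assert (P1 := Cmod_ge_0 (a k)).
    apply Rmult_le_pos; [|apply pow_le; lra]. apply Rmult_le_pos; [exact P|].
    now apply Rmult_le_pos. }
  assert (HK : 0 <= K).
  { eapply Rle_trans; [|apply (sum_n_le_Series _ 0 Hterm EK)]. rewrite sum_O. apply Hterm. }
  assert (Hquad : forall w, Cmod w <= rho ->
     rho ^ 2 * Cmod (f w - f z - l * (w - z)) <= K * Cmod (w - z) ^ 2).
  { intros w Hw.
    assert (Lw := proj1 (is_pseries_Cmod _ _ _) (Hf w ltac:(unfold in_disk; lra))).
    assert (Lz := proj1 (is_pseries_Cmod _ _ _) (Hf z ltac:(unfold in_disk; lra))).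
    assert (Ll := proj1 (is_pseries_Cmod _ _ _) Hl).
    apply is_lim_seq_incr_1 in Lw. apply is_lim_seq_incr_1 in Lz.
    assert (L : is_lim_seq (fun n => K * Cmod (w - z) ^ 2 + rho ^ 2 *
        (Cmod (psum a w (S n) - f w) + Cmod (psum a z (S n) - f z)
         + Cmod (psum (derived_coef a) z n - l) * Cmod (w - z)))
        (K * Cmod (w - z) ^ 2 + rho ^ 2 * (0 + 0 + 0 * Cmod (w - z)))).
    { repeat first [exact Lw | exact Lz | exact Ll | apply is_lim_seq_const
                   | apply is_lim_seq_plus' | apply is_lim_seq_mult']. }
    replace (K * Cmod (w - z) ^ 2 + rho ^ 2 * (0 + 0 + 0 * Cmod (w - z)))
      with (K * Cmod (w - z) ^ 2) in L by ring.
    refine (is_lim_seq_le _ _ _ _ _ (is_lim_seq_const _) L). intros n.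
    assert (T := psum_taylor_bound a z w rho n ltac:(lra) Hw).
    assert (S1 := sum_n_le_Series _ (S n) Hterm EK). fold K in S1.
    apply (Rmult_le_compat_r (Cmod (w - z) ^ 2)) in S1; [|apply pow2_ge_0].
    set (X := (psum a w (S n) - psum a z (S n) - psum (derived_coef a) z n * (w - z))%C) in *.
    replace (f w - f z - l * (w - z))%C
      with (X + (- (psum a w (S n) - f w) + ((psum a z (S n) - f z)
            + (psum (derived_coef a) z n - l) * (w - z))))%C by (unfold X; ring).
    assert (T1 := Cmod_triangle X (- (psum a w (S n) - f w) + ((psum a z (S n) - f z)
            + (psum (derived_coef a) z n - l) * (w - z)))).
    assert (T2 := Cmod_triangle (- (psum a w (S n) - f w)) ((psum a z (S n) - f z)
            + (psum (derived_coef a) z n - l) * (w - z))).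
    assert (T3 := Cmod_triangle (psum a z (S n) - f z)
            ((psum (derived_coef a) z n - l) * (w - z))).
    rewrite Cmod_opp in T2. rewrite Cmod_mult in T3.
    assert (P := pow2_ge_0 rho).
    eapply Rle_trans; [apply Rmult_le_compat_l; [exact P|
      eapply Rle_trans; [exact T1|apply Rplus_le_compat_l;
      eapply Rle_trans; [exact T2|apply Rplus_le_compat_l, T3]]]|].
    lra. }
  split; [apply is_linear_scal_l|].
  intros y Hy. rewrite <- (is_filter_lim_locally_unique (V := AbsRing_NormedModule C_AbsRing) z y Hy). clear y Hy.
  intros eps.
  assert (Hd : 0 < Rmin (rho - Cmod z) (eps * rho ^ 2 / (K + 1))).
  { apply Rmin_pos; [lra|]. apply Rdiv_lt_0_compat; [|lra].
    apply Rmult_lt_0_compat; [apply cond_pos|apply pow_lt; lra]. }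
  exists (mkposreal _ Hd). intros w Hw. change (Cmod (w - z) < Rmin (rho - Cmod z) (eps * rho ^ 2 / (K + 1))) in Hw.
  change (Cmod (f w - f z - (w - z) * l) <= eps * Cmod (w - z)).
  replace ((w - z) * l)%C with (l * (w - z))%C by ring.
  assert (H1 := Rmin_l (rho - Cmod z) (eps * rho ^ 2 / (K + 1))).
  assert (H2 := Rmin_r (rho - Cmod z) (eps * rho ^ 2 / (K + 1))).
  assert (Hwr : Cmod w <= rho).
  { replace w with (w - z + z)%C by ring. eapply Rle_trans; [apply Cmod_triangle|]. lra. }
  specialize (Hquad w Hwr).
  apply Rmult_le_reg_l with (rho ^ 2); [apply pow_lt; lra|].
  eapply Rle_trans; [exact Hquad|].
  assert (H3 : (K + 1) * Cmod (w - z) <= eps * rho ^ 2).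
  { assert (H4 : Cmod (w - z) <= eps * rho ^ 2 / (K + 1)) by lra.
    apply (Rmult_le_compat_l (K + 1)) in H4; [|lra].
    replace ((K + 1) * (eps * rho ^ 2 / (K + 1))) with (eps * rho ^ 2) in H4 by (field; lra). exact H4. }
  assert (H5 := Cmod_ge_0 (w - z)). nra.
Qed.

Lemma pseries_C_derive (a : nat -> C) (f : C -> C) :
  (forall z, in_disk z -> is_pseries a z (f z)) ->
  forall z, in_disk z -> is_pseries (derived_coef a) z (C_derive f z).
Proof.
  intros Hf z Hz. destruct (pseries_is_derive a f Hf z Hz) as [l [Hl Hd]].
  now rewrite (is_C_derive_unique f z l Hd).
Qed.

(** The hypothesis says that [x * D' x >= 0] for the sum [D], so that [D] is
nondecreasing on [0, 1). *)
Lemma coef0_le_PSeries (d : nat -> R) :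
  Rbar_le 1 (CV_radius d) ->
  (forall t, 0 <= t < 1 -> 0 <= PSeries (fun k => INR k * d k) t) ->
  forall t, 0 <= t < 1 -> d 0%nat <= PSeries d t.
Proof.
  intros Hrad H t Ht.
  destruct (Req_dec t 0) as [->|T0]; [rewrite PSeries_0; lra|].
  assert (E : forall x, PSeries (fun k => INR k * d k) x = x * PSeries (PS_derive d) x).
  { intros x. rewrite <- PSeries_incr_1. apply PSeries_ext. intros [|k]; [apply Rmult_0_l|reflexivity]. }
  destruct (MVT_cor2 (PSeries d) (PSeries (PS_derive d)) 0 t) as [c [Hc Hct]]; [lra| |].
  - intros x Hx. apply is_derive_Reals, is_derive_PSeries, radius_ge_1_inside; [exact Hrad|lra].
  - rewrite PSeries_0 in Hc. specialize (H c ltac:(lra)). rewrite E in H.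
    assert (0 <= PSeries (PS_derive d) c) by nra. nra.
Qed.

Lemma coef0_le_PSeries_of_euler_twice (d : nat -> R) :
  Rbar_le 1 (CV_radius d) ->
  (forall t, 0 <= t < 1 -> 0 <= PSeries (fun k => INR k * (INR k * d k)) t) ->
  forall t, 0 <= t < 1 -> d 0%nat <= PSeries d t.
Proof.
  intros Hrad H. apply coef0_le_PSeries; [exact Hrad|]. intros t Ht.
  assert (H0 := coef0_le_PSeries (fun k => INR k * d k)). cbv beta in H0.
  rewrite radius_INR_mul in H0. specialize (H0 Hrad H t Ht). simpl INR in H0. lra.
Qed.

(** Comparing the mean squares of [z * g' z] and [z * h' z] gives the inequality with
weights [k ^ 2], that is, after two Euler operators; each of them is undone by
monotonicity. The constant terms, on which the derivatives give no information,
are cancelled by the value at 0. *)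
Lemma coefficients_sqr_le_of_derivative_le (a b : nat -> C) (h g : C -> C) :
  (forall z, in_disk z -> is_pseries a z (h z)) ->
  (forall z, in_disk z -> is_pseries b z (g z)) ->
  (forall z, in_disk z -> Cmod (C_derive g z) <= Cmod (C_derive h z)) ->
  forall t, 0 <= t < 1 ->
  Series (fun k => Cmod (b (S k)) ^ 2 * t ^ S k) <= Series (fun k => Cmod (a (S k)) ^ 2 * t ^ S k).
Proof.
  intros Ha Hb Hd t Ht.
  set (A := fun k => Cmod (a k) ^ 2). set (B := fun k => Cmod (b k) ^ 2).
  assert (RA : Rbar_le 1 (CV_radius A)) by exact (radius_ge_1_square _ (pseries_disk_radius a h Ha)).
  assert (RB : Rbar_le 1 (CV_radius B)) by exact (radius_ge_1_square _ (pseries_disk_radius b g Hb)).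
  assert (RA2 : Rbar_le 1 (CV_radius (fun k => INR k * (INR k * A k)))).
  { rewrite (radius_INR_mul (fun k => INR k * A k)). now rewrite radius_INR_mul. }
  assert (RB2 : Rbar_le 1 (CV_radius (fun k => INR k * (INR k * B k)))).
  { rewrite (radius_INR_mul (fun k => INR k * B k)). now rewrite radius_INR_mul. }
  (* The assertion is that the sum of [d] is at least its constant term. *)
  set (d := PS_minus A B).
  assert (Rd : Rbar_le 1 (CV_radius d)).
  { eapply Rbar_le_trans; [|exact (CV_radius_plus A (PS_opp B))]. rewrite CV_radius_opp.
    apply Rbar_min_case; assumption. }
  assert (Hmain : forall x, 0 <= x < 1 ->
     PSeries (fun k => INR k * (INR k * B k)) x <= PSeries (fun k => INR k * (INR k * A k)) x).
  { intros x Hx. set (s := sqrt x).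
    assert (Hs : 0 <= s < 1).
    { split; [apply sqrt_pos|]. rewrite <- sqrt_1. apply sqrt_lt_1; lra. }
    assert (Es : s ^ 2 = x) by (apply pow2_sqrt; lra).
    assert (Hzd : forall z, in_disk z -> Cmod (z * C_derive g z) <= Cmod (z * C_derive h z)).
    { intros z Hz. rewrite !Cmod_mult. apply Rmult_le_compat_l; [apply Cmod_ge_0|now apply Hd]. }
    assert (Hcmp := coefficients_sqr_le_of_Cmod_le
      (PS_incr_1 (V := C_NormedModule) (derived_coef b)) (PS_incr_1 (V := C_NormedModule) (derived_coef a))
      (fun z => z * C_derive g z)%C (fun z => z * C_derive h z)%C
      (fun z Hz => is_pseries_incr_1 _ z _ (pseries_C_derive b g Hb z Hz))
      (fun z Hz => is_pseries_incr_1 _ z _ (pseries_C_derive a h Ha z Hz))).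
    assert (Ek : forall (c : nat -> C) k, Cmod (PS_incr_1 (V := C_NormedModule) (derived_coef c) k) ^ 2
        = INR k * (INR k * Cmod (c k) ^ 2)).
    { intros c [|k]; simpl PS_incr_1.
      - change (Cmod (RtoC 0) ^ 2 = INR 0 * (INR 0 * Cmod (c 0%nat) ^ 2)). rewrite Cmod_0. simpl. ring.
      - unfold derived_coef. rewrite Cmod_mult, Cmod_R, Rabs_pos_eq by apply pos_INR. ring. }
    assert (Hn : forall n, sum_n (fun k => INR k * (INR k * B k) * x ^ k) n
        <= PSeries (fun k => INR k * (INR k * A k)) x).
    { intros n. specialize (Hcmp Hzd s n Hs).
      rewrite Es in Hcmp. unfold PSeries.
      rewrite (sum_n_ext _ (fun k => INR k * (INR k * B k) * x ^ k)) in Hcmp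
        by (intros k; now rewrite Ek).
      rewrite (Series_ext _ (fun k => INR k * (INR k * A k) * x ^ k)) in Hcmp
        by (intros k; now rewrite Ek).
      exact Hcmp. }
    assert (L := Series_correct _ (radius_ge_1_ex_series _ x RB2 Hx)).
    exact (is_lim_seq_le _ _ (Finite _) (Finite _) Hn L (is_lim_seq_const _)). }
  assert (Hdd : forall x, 0 <= x < 1 -> 0 <= PSeries (fun k => INR k * (INR k * d k)) x).
  { intros x Hx. specialize (Hmain x Hx).
    rewrite (PSeries_ext _ (PS_minus (fun k => INR k * (INR k * A k)) (fun k => INR k * (INR k * B k)))).
    - rewrite PSeries_minus; [lra| |]; apply CV_radius_inside, radius_ge_1_inside; assumption.
    - intros k. unfold d, PS_minus, PS_plus, PS_opp. 
      change (INR k * (INR k * (A k + - B k)) = INR k * (INR k * A k) + - (INR k * (INR k * B k))). ring. }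
  assert (H := coef0_le_PSeries_of_euler_twice d Rd Hdd t Ht).
  unfold d in H at 2. rewrite PSeries_minus in H
    by (apply CV_radius_inside, radius_ge_1_inside; assumption).
  assert (EA := radius_ge_1_ex_series A t RA Ht). assert (EB := radius_ge_1_ex_series B t RB Ht).
  unfold PSeries in H. rewrite (Series_incr_1 _ EA), (Series_incr_1 _ EB) in H.
  change (d 0%nat) with (A 0%nat + - B 0%nat) in H. simpl pow in H at 1 3. unfold A, B in H |- *. simpl in H |- *. lra.
Qed.

(** * The Bohr inequality *)

Lemma is_series_geom_scal (c q : R) :
  0 <= q < 1 -> is_series (fun k => c * q ^ k) (c / (1 - q)).
Proof.
  intros Hq. unfold Rdiv. apply (is_series_scal (V := R_NormedModule) c). apply is_series_geom.
  rewrite Rabs_pos_eq; lra.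
Qed.

(** A Cauchy-Schwarz bound with a free parameter [c], from
[2 * c * q_k * y ^ k <= q_k ^ 2 + c ^ 2 * y ^ (2 * k)] multiplied by [t ^ k]. *)
Lemma linear_series_le_energy (q : nat -> R) (c y t r : R) :
  0 < c -> 0 < y <= 1 -> 0 <= t < 1 -> r = y * t ->
  ex_series (fun k => q (S k) * r ^ S k) ->
  ex_series (fun k => q (S k) ^ 2 * t ^ S k) ->
  2 * c * Series (fun k => q (S k) * r ^ S k)
  <= Series (fun k => q (S k) ^ 2 * t ^ S k) + c ^ 2 * (y * r / (1 - y * r)).
Proof.
  intros Hc Hy Ht Hr E1 E2.
  assert (Hr0 : 0 <= r <= t) by (rewrite Hr; split; nra).
  assert (Hyr : 0 <= y * r < 1) by (split; nra).
  assert (HG := is_series_geom_scal (c ^ 2 * (y * r)) (y * r) Hyr).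
  replace (c ^ 2 * (y * r / (1 - y * r))) with (c ^ 2 * (y * r) / (1 - y * r)) by (field; lra).
  assert (E1' := is_series_scal (V := R_NormedModule) (2 * c) _ _ (Series_correct _ E1)).
  assert (S2 := is_series_plus _ _ _ _ (Series_correct _ E2) HG).
  refine (is_lim_seq_le _ _ (Finite _) (Finite _) _ E1' S2).
  intros n. apply sum_n_le. intros k _.
  change (2 * c * (q (S k) * r ^ S k) <= q (S k) ^ 2 * t ^ S k + c ^ 2 * (y * r) * (y * r) ^ k).
  replace (c ^ 2 * (y * r) * (y * r) ^ k) with (c ^ 2 * (y * r) ^ S k) by (simpl; ring).
  rewrite Hr, !Rpow_mult_distr. set (Y := y ^ S k).
  assert (HT : 0 <= t ^ S k) by (apply pow_le; lra). set (T := t ^ S k) in *.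
  assert (0 <= T * (q (S k) - c * Y) ^ 2) by (apply Rmult_le_pos; [exact HT|apply pow2_ge_0]).
  simpl in *. nra.
Qed.

(** Cauchy-Schwarz with the weight [t = r / x], for which the energy bound and the
geometric series balance: the result is an equality for
[q k = (1 - x ^ 2) * x ^ (k - 1)]. Because [t < 1] is required, this works only
for [r < x]. *)
Lemma linear_sum_le (q : nat -> R) (x r : R) :
  0 < r < x -> x <= 1 ->
  ex_series (fun k => q (S k) * r ^ S k) ->
  (forall t, 0 <= t < 1 -> ex_series (fun k => q (S k) ^ 2 * t ^ S k)) ->
  (forall t, 0 <= t < 1 ->
     (1 - x ^ 2 * t) * Series (fun k => q (S k) ^ 2 * t ^ S k) <= t * (1 - x ^ 2) ^ 2) ->
  (1 - x * r) * Series (fun k => q (S k) * r ^ S k) <= r * (1 - x ^ 2).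
Proof.
  intros Hr Hx E1 E2 Hen.
  assert (Ht : 0 <= r / x < 1).
  { split; [apply Rlt_le, Rdiv_lt_0_compat; lra|]. apply Rmult_lt_reg_r with x; [lra|].
    unfold Rdiv. rewrite Rmult_assoc, Rinv_l; lra. }
  set (t := r / x) in *. assert (Ext : r = x * t) by (unfold t; field; lra).
  specialize (Hen t Ht). replace (x ^ 2 * t) with (x * r) in Hen by (rewrite Ext; ring).
  set (E := Series (fun k => q (S k) ^ 2 * t ^ S k)) in *.
  set (L := Series (fun k => q (S k) * r ^ S k)) in *.
  assert (Hxr : 0 < 1 - x * r) by nra.
  (* The optimal parameter is [(1 - x ^ 2) / x], which vanishes for [x = 1]; hence [eps]. *)
  apply le_epsilon. intros eps Heps.
  set (D := 1 - x ^ 2 + eps). assert (HD0 : 0 <= 1 - x ^ 2) by nra.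
  assert (HD : 0 < D) by (unfold D; lra).
  assert (H := linear_series_le_energy q (D / x) x t r ltac:(apply Rdiv_lt_0_compat; lra) ltac:(lra) Ht Ext E1 (E2 t Ht)).
  fold E L in H.
  assert (H1 : 2 * D * x * ((1 - x * r) * L) <= x ^ 2 * ((1 - x * r) * E) + D ^ 2 * (x * r)).
  { apply (Rmult_le_compat_l (x ^ 2 * (1 - x * r))) in H; [|nra].
    replace (x ^ 2 * (1 - x * r) * (2 * (D / x) * L)) with (2 * D * x * ((1 - x * r) * L)) in H
      by (field; lra).
    replace (x ^ 2 * (1 - x * r) * (E + (D / x) ^ 2 * (x * r / (1 - x * r))))
      with (x ^ 2 * ((1 - x * r) * E) + D ^ 2 * (x * r)) in H by (field; lra).
    exact H. }
  assert (H2 : x ^ 2 * ((1 - x * r) * E) <= D ^ 2 * (x * r)).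
  { apply Rle_trans with (x ^ 2 * (t * (1 - x ^ 2) ^ 2)).
    - apply Rmult_le_compat_l; [apply pow2_ge_0|exact Hen].
    - replace (x ^ 2 * (t * (1 - x ^ 2) ^ 2)) with ((1 - x ^ 2) ^ 2 * (x * r)) by (rewrite Ext; ring).
      apply Rmult_le_compat_r; [nra|]. apply pow_incr. unfold D. lra. }
  apply Rle_trans with (r * D).
  - apply Rmult_le_reg_l with (2 * D * x); [nra|]. lra.
  - unfold D. assert (r < 1) by lra. nra.
Qed.

Lemma radius_ge_1_ex_series_tail (u : nat -> R) r :
  Rbar_le 1 (CV_radius u) -> 0 <= r < 1 -> ex_series (fun k => u (S k) * r ^ S k).
Proof.
  intros H Hr. apply (ex_series_incr_1 (fun k => u k * r ^ k)). now apply radius_ge_1_ex_series.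
Qed.

Lemma harmonic_mapping_h_le_1 f h g a b :
  harmonic_mapping f h g a b -> forall z, in_disk z -> Cmod (h z) <= 1.
Proof.
  intros H z Hz. destruct (Lub_Rbar_correct (fun x : R => exists z : C, in_disk z /\ x = Cmod (h z))) as [Hub _].
  assert (E := hm_norm_h _ _ _ _ _ H). unfold sup_norm in E. rewrite E in Hub.
  apply (Hub (Cmod (h z))). now exists z.
Qed.

(** Inserting the four bounds, the right-hand side exceeds the left-hand side by a
positive multiple of [(1 - x) ^ 3 * (15 + 6 * x - x ^ 2)]. The term of order
[(1 - x) ^ 2] cancels exactly because the coefficient is [3 / 8]. *)
Lemma bohr_bound_at_one_fifth (x LA LB EA EB : R) :
  0 <= x <= 1 ->
  (5 - x ^ 2) * EA <= (1 - x ^ 2) ^ 2 -> (5 - x ^ 2) * EB <= (1 - x ^ 2) ^ 2 ->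
  (5 - x) * LA <= 1 - x ^ 2 -> (5 - x) * LB <= 1 - x ^ 2 ->
  x + (LA + LB) + 3 / 8 * (EA + EB) <= 1.
Proof.
  intros Hx HEA HEB HLA HLB.
  assert (P1 : 0 < 5 - x ^ 2) by nra. assert (P2 : 0 < 5 - x) by lra.
  set (e := (1 - x ^ 2) ^ 2 / (5 - x ^ 2)). set (l := (1 - x ^ 2) / (5 - x)).
  assert (B1 : forall E, (5 - x ^ 2) * E <= (1 - x ^ 2) ^ 2 -> E <= e).
  { intros E H. apply Rmult_le_reg_l with (5 - x ^ 2); [exact P1|].
    replace ((5 - x ^ 2) * e) with ((1 - x ^ 2) ^ 2) by (unfold e; field; lra). exact H. }
  assert (B2 : forall E, (5 - x) * E <= 1 - x ^ 2 -> E <= l).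
  { intros E H. apply Rmult_le_reg_l with (5 - x); [exact P2|].
    replace ((5 - x) * l) with (1 - x ^ 2) by (unfold l; field; lra). exact H. }
  apply B1 in HEA, HEB. apply B2 in HLA, HLB.
  enough (x + 2 * l + 3 / 4 * e <= 1) by lra.
  apply Rminus_le.
  replace (x + 2 * l + 3 / 4 * e - 1)
    with (- (3 / 4 * ((1 - x) ^ 3 * (15 + 6 * x - x ^ 2)) / ((5 - x) * (5 - x ^ 2))))
    by (unfold e, l; field; lra).
  apply Ropp_le_cancel. rewrite Ropp_involutive, Ropp_0.
  apply Rmult_le_pos; [|apply Rlt_le, Rinv_0_lt_compat, Rmult_lt_0_compat; lra].
  apply Rmult_le_pos; [lra|]. apply Rmult_le_pos; [apply pow_le; lra|nra].
Qed.

(** The sum increases with [r], so only [r = 1 / 5] matters. If [|a_0| > 1 / 5] the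
sharp bounds apply to both coefficient sequences; for smaller [|a_0|] there is
enough slack for the cruder choice of equal weights in Cauchy-Schwarz. *)
Lemma bohr_inequality f h g a b :
  harmonic_mapping f h g a b ->
  forall r, 0 <= r <= 1 / 5 -> bohr_series_converge a b r /\ bohr_sum (3 / 8) a b r <= 1.
Proof.
  intros Hm.
  assert (Ha := hm_series_h _ _ _ _ _ Hm). assert (Hb := hm_series_g _ _ _ _ _ Hm).
  assert (Hbd := harmonic_mapping_h_le_1 _ _ _ _ _ Hm).
  assert (RA := pseries_disk_radius a h Ha). assert (RB := pseries_disk_radius b g Hb).
  assert (RA2 := radius_ge_1_square _ RA). assert (RB2 := radius_ge_1_square _ RB).
  assert (EA := fun r Hr => radius_ge_1_ex_series_tail _ r RA Hr). assert (EB := fun r Hr => radius_ge_1_ex_series_tail _ r RB Hr).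
  assert (EA2 := fun r Hr => radius_ge_1_ex_series_tail _ r RA2 Hr). assert (EB2 := fun r Hr => radius_ge_1_ex_series_tail _ r RB2 Hr).
  cbv beta in EA, EB, EA2, EB2.
  assert (EL : forall r, 0 <= r < 1 -> ex_series (fun k => linear_term a b r (S k))).
  { intros r Hr. apply (ex_series_ext _ _ (fun k => eq_sym (Rmult_plus_distr_r _ _ _))).
    apply (ex_series_plus (V := R_NormedModule)); [now apply EA|now apply EB]. }
  assert (EQ : forall r, 0 <= r < 1 -> ex_series (fun k => quadratic_term a b r (S k))).
  { intros r Hr. apply (ex_series_ext _ _ (fun k => eq_sym (Rmult_plus_distr_r _ _ _))).
    apply (ex_series_plus (V := R_NormedModule)); [now apply EA2|now apply EB2]. }
  intros r Hr. split; [split; [apply EL|apply EQ]; lra|].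
  assert (H5 : 0 <= 1 / 5 < 1) by lra.
  apply Rle_trans with (bohr_sum (3 / 8) a b (1 / 5)).
  { unfold bohr_sum. apply Rplus_le_compat; [apply Rplus_le_compat_l|apply Rmult_le_compat_l; [lra|]].
    - apply Series_le; [|now apply EL]. intros k. unfold linear_term.
      assert (P := Cmod_ge_0 (a (S k))). assert (P' := Cmod_ge_0 (b (S k))).
      split; [apply Rmult_le_pos; [lra|apply pow_le; lra]|].
      apply Rmult_le_compat_l; [lra|]. apply pow_incr; lra.
    - apply Series_le; [|now apply EQ]. intros k. unfold quadratic_term.
      assert (P := pow2_ge_0 (Cmod (a (S k)))). assert (P' := pow2_ge_0 (Cmod (b (S k)))).
      split; [apply Rmult_le_pos; [lra|apply pow_le; lra]|].
      apply Rmult_le_compat_l; [lra|]. apply pow_incr; lra. }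
  clear r Hr.
  set (x := Cmod (a 0%nat)).
  assert (Hx0 : 0 <= x) by apply Cmod_ge_0.
  assert (Hx1 : x <= 1) by exact (bounded_coef0_le_1 h a Ha Hbd).
  assert (NA := fun t Ht => bounded_energy h a Ha Hbd t Ht). fold x in NA.
  assert (NB : forall t, 0 <= t < 1 ->
    (1 - x ^ 2 * t) * Series (fun k => Cmod (b (S k)) ^ 2 * t ^ S k) <= t * (1 - x ^ 2) ^ 2).
  { intros t Ht. eapply Rle_trans; [|apply (NA t Ht)]. apply Rmult_le_compat_l; [nra|].
    exact (coefficients_sqr_le_of_derivative_le a b h g Ha Hb (hm_dilatation _ _ _ _ _ Hm) t Ht). }
  unfold bohr_sum. fold x.
  rewrite (Series_ext (fun k => linear_term a b (1 / 5) (S k)) _ (fun k => Rmult_plus_distr_r _ _ _)).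
  rewrite (Series_ext (fun k => quadratic_term a b (1 / 5) (S k)) _ (fun k => Rmult_plus_distr_r _ _ _)).
  rewrite !Series_plus by auto.
  assert (NA5 := NA _ H5). assert (NB5 := NB _ H5).
  (* Equal weights: [2 * |c_k| <= |c_k| ^ 2 + 1], and the weights [(1 / 5) ^ k] add up to [1 / 4]. *)
  assert (Hcrude : forall c : nat -> C, ex_series (fun k => Cmod (c (S k)) * (1 / 5) ^ S k) ->
      ex_series (fun k => Cmod (c (S k)) ^ 2 * (1 / 5) ^ S k) ->
      2 * Series (fun k => Cmod (c (S k)) * (1 / 5) ^ S k)
      <= Series (fun k => Cmod (c (S k)) ^ 2 * (1 / 5) ^ S k) + 1 / 4).
  { intros c E1 E2.
    assert (H := linear_series_le_energy (fun k => Cmod (c k)) 1 1 (1 / 5) (1 / 5)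
       ltac:(lra) ltac:(lra) H5 ltac:(lra) E1 E2). cbv beta in H. lra. }
  assert (CA := Hcrude a (EA _ H5) (EA2 _ H5)). assert (CB := Hcrude b (EB _ H5) (EB2 _ H5)).
  destruct (Rle_lt_dec x (1 / 5)) as [Hx|Hx].
  - set (U := Series (fun k => Cmod (a (S k)) ^ 2 * (1 / 5) ^ S k)) in *.
    set (V := Series (fun k => Cmod (b (S k)) ^ 2 * (1 / 5) ^ S k)) in *.
    assert (Hy : 0 <= x ^ 2 <= 1 / 25) by nra.
    assert (HW : forall W, (1 - x ^ 2 * (1 / 5)) * W <= 1 / 5 * (1 - x ^ 2) ^ 2 -> W <= 1 / 4).
    { intros W HW. set (y := x ^ 2) in *.
      assert (Hsq : (1 - y) ^ 2 <= 1) by nra.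
      apply Rnot_lt_le. intros HW4.
      assert (124 / 125 * (1 / 4) <= (1 - y * (1 / 5)) * W) by (apply Rmult_le_compat; lra).
      lra. }
    assert (HU := HW _ NA5). assert (HV := HW _ NB5). lra.
  - assert (LA := linear_sum_le (fun k => Cmod (a k)) x (1 / 5) ltac:(lra) Hx1 (EA _ H5) EA2 NA).
    assert (LB := linear_sum_le (fun k => Cmod (b k)) x (1 / 5) ltac:(lra) Hx1 (EB _ H5) EB2 NB).
    cbv beta in LA, LB. apply bohr_bound_at_one_fifth; lra.
Qed.

(** * Extremal mappings *)

Definition moebius_coef (x : R) (k : nat) : C :=
  match k with O => RtoC x | S j => RtoC (- ((1 - x ^ 2) * x ^ j)) end.
Definition moebius_centered_coef (x : R) (k : nat) : C :=
  match k with O => RtoC 0 | S j => moebius_coef x (S j) end.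
Definition moebius (x : R) (z : C) : C := ((x - z) / (1 - x * z))%C.
(** Subtracting the value [x] at 0 makes the constant coefficient vanish without
changing the derivative, so that the dilatation condition holds with equality. *)
Definition moebius_centered (x : R) (z : C) : C := (moebius x z - x)%C.

Section Extremal.

Context (x : R) (Hx : 0 <= x < 1).

Lemma moebius_denominator z : in_disk z -> (1 - RtoC x * z)%C <> 0.
Proof.
  unfold in_disk. intros Hz E.
  assert (E' : (RtoC x * z)%C = 1) by (replace (RtoC x * z)%C with (1 - (1 - RtoC x * z))%C by ring; rewrite E; ring).
  assert (M : Cmod (RtoC x * z) = 1) by (rewrite E'; apply Cmod_1).
  rewrite Cmod_mult, Cmod_R, Rabs_pos_eq in M by lra. assert (P := Cmod_ge_0 z). nra.
Qed.

(** Multiplying by the denominator makes the partial sums telescope. *)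
Lemma psum_moebius z n :
  (psum (moebius_coef x) z n * (1 - x * z)
   = x - z + RtoC ((1 - x ^ 2) * x ^ n) * Cpow z (S n))%C.
Proof.
  induction n as [|n IH].
  - rewrite psum_O. simpl. rewrite !RtoC_mult, RtoC_minus, !RtoC_mult. ring.
  - rewrite psum_S, Cmult_plus_distr_r, IH.
    cbn [moebius_coef]. rewrite !(Cpow_S z), <- (tech_pow_Rmult x n).
    rewrite RtoC_opp, !RtoC_mult. ring.
Qed.

Lemma is_pseries_moebius z : in_disk z -> is_pseries (moebius_coef x) z (moebius x z).
Proof.
  intros Hz. assert (Hd := moebius_denominator z Hz). unfold in_disk in Hz.
  apply is_pseries_Cmod.
  apply (is_lim_seq_ext (fun n => (1 - x ^ 2) / Cmod (1 - x * z) * Cmod z * (x * Cmod z) ^ n)).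
  - intros n.
    replace (psum (moebius_coef x) z n - moebius x z)%C
      with (RtoC ((1 - x ^ 2) * x ^ n) * Cpow z (S n) / (1 - x * z))%C.
    + rewrite Cmod_div by exact Hd. rewrite Cmod_mult, Cmod_R, Cmod_pow, Rabs_pos_eq.
      * rewrite Rpow_mult_distr. simpl. field.
        intros E. apply Hd. now apply Cmod_eq_0.
      * apply Rmult_le_pos; [nra|apply pow_le; lra].
    + unfold moebius. assert (H := psum_moebius z n).
      replace (psum (moebius_coef x) z n)
        with ((psum (moebius_coef x) z n * (1 - x * z)) / (1 - x * z))%C by (field; exact Hd).
      rewrite H. field. exact Hd.
  - replace (Finite 0) with (Finite ((1 - x ^ 2) / Cmod (1 - x * z) * Cmod z * 0)) by (f_equal; ring).
    apply is_lim_seq_mult'; [apply is_lim_seq_const|]. apply is_lim_seq_geom.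
    assert (P := Cmod_ge_0 z). rewrite Rabs_pos_eq by nra.
    apply Rle_lt_trans with (1 * Cmod z); [apply Rmult_le_compat_r|]; lra.
Qed.

Lemma is_pseries_moebius_centered z : in_disk z -> is_pseries (moebius_centered_coef x) z (moebius_centered x z).
Proof.
  intros Hz. assert (H := proj1 (is_pseries_Cmod _ _ _) (is_pseries_moebius z Hz)).
  apply is_pseries_Cmod. eapply is_lim_seq_ext; [|exact H]. intros n. cbv beta. f_equal.
  unfold moebius_centered.
  replace (psum (moebius_centered_coef x) z n) with (psum (moebius_coef x) z n - x)%C; [ring|].
  induction n as [|n IH]; [rewrite !psum_O; simpl; ring|].
  rewrite !psum_S, <- IH. simpl. ring.
Qed.

Lemma Cmod_moebius_le z : in_disk z -> Cmod (moebius x z) <= 1.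
Proof.
  intros Hz. assert (Hd := moebius_denominator z Hz). unfold in_disk in Hz.
  unfold moebius. rewrite Cmod_div by exact Hd.
  assert (P : 0 < Cmod (1 - x * z)) by now apply Cmod_gt_0.
  apply Rmult_le_reg_r with (Cmod (1 - x * z)); [exact P|].
  unfold Rdiv. rewrite Rmult_assoc, Rinv_l, Rmult_1_l, Rmult_1_r by lra.
  apply Rsqr_incr_0_var; [|lra]. rewrite !Rsqr_pow2.
  assert (Hz2 : Cmod z ^ 2 <= 1) by (assert (P1 := Cmod_ge_0 z); nra).
  revert Hz2. unfold Cmod. rewrite !pow2_sqrt by (apply Rplus_le_le_0_compat; apply pow2_ge_0).
  destruct z as [u v]. simpl. intros Hz2.
  assert (Hprod : 0 <= (1 - x ^ 2) * (1 - (u * (u * 1) + v * (v * 1))))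
    by (apply Rmult_le_pos; nra).
  lra.
Qed.

(** The value at [-s] is at least [s], so the moduli approach 1. *)
Lemma sup_norm_moebius : sup_norm (moebius x) = 1.
Proof.
  apply is_lub_Rbar_unique. split.
  - intros y [z [Hz ->]]. now apply Cmod_moebius_le.
  - intros m Hm.
    assert (Hs : forall s, 0 <= s < 1 -> Rbar_le s m).
    { intros s Hs. assert (Hd : in_disk (RtoC (- s))).
      { unfold in_disk. rewrite Cmod_R, Rabs_Ropp, Rabs_pos_eq; lra. }
      eapply Rbar_le_trans; [|apply Hm; exists (RtoC (- s)); split; [exact Hd|reflexivity]].
      assert (Hden : 0 < 1 + x * s) by nra.
      simpl. replace (moebius x (RtoC (- s))) with (RtoC ((x + s) / (1 + x * s))).
      - rewrite Cmod_R. eapply Rle_trans; [|apply Rle_abs].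
        apply Rmult_le_reg_r with (1 + x * s); [exact Hden|].
        replace ((x + s) / (1 + x * s) * (1 + x * s)) with (x + s) by (field; lra).
        assert (0 <= x * (1 - s * s)) by (apply Rmult_le_pos; nra). lra.
      - unfold moebius. rewrite RtoC_div, RtoC_opp, !RtoC_plus, RtoC_mult by lra.
        unfold Cdiv. f_equal; [|f_equal]; ring_C. }
    destruct m as [m| |]; [|exact I|exact (Hs 0 ltac:(lra))].
    simpl in Hs |- *. destruct (Rle_lt_dec 1 m) as [|Hlt]; [assumption|].
    assert (H0 := Hs 0 ltac:(lra)). assert (H1 := Hs ((m + 1) / 2) ltac:(lra)). lra.
Qed.

Lemma harmonic_mapping_moebius :
  harmonic_mapping (fun z => (moebius x z + Cconj (moebius_centered x z))%C)
    (moebius x) (moebius_centered x) (moebius_coef x) (moebius_centered_coef x).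
Proof.
  constructor.
  - reflexivity.
  - intros z Hz. destruct (pseries_is_derive _ _ is_pseries_moebius z Hz) as [l [_ Hl]]. now exists l.
  - intros z Hz. destruct (pseries_is_derive _ _ is_pseries_moebius_centered z Hz) as [l [_ Hl]]. now exists l.
  - exact is_pseries_moebius.
  - exact is_pseries_moebius_centered.
  - reflexivity.
  - exact sup_norm_moebius.
  - intros z Hz. 
    assert (H1 := pseries_C_derive _ _ is_pseries_moebius z Hz).
    assert (H2 := pseries_C_derive _ _ is_pseries_moebius_centered z Hz).
    apply Req_le, f_equal.
    (* The derived coefficients ignore the constant term, so both derivatives sum the same series. *)
    exact (filterlim_locally_unique (V := C_NormedModule) _ _ _ H2 H1).
Qed.

Context (r : R) (Hr : 0 <= r < 1).

Lemma is_series_linear_moebius :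
  is_series (fun k => linear_term (moebius_coef x) (moebius_centered_coef x) r (S k))
    (2 * (1 - x ^ 2) * r / (1 - x * r)).
Proof.
  eapply is_series_ext; [|apply is_series_geom_scal; nra].
  intros k. unfold linear_term. cbn [moebius_coef moebius_centered_coef].
  assert (P : 0 <= (1 - x ^ 2) * x ^ k) by (apply Rmult_le_pos; [nra|apply pow_le; lra]).
  rewrite !Cmod_R, Rabs_Ropp, Rabs_pos_eq by exact P.
  rewrite Rpow_mult_distr. simpl. ring.
Qed.

Lemma is_series_quadratic_moebius :
  is_series (fun k => quadratic_term (moebius_coef x) (moebius_centered_coef x) r (S k))
    (2 * (1 - x ^ 2) ^ 2 * r / (1 - x ^ 2 * r)).
Proof.
  eapply is_series_ext; [|apply is_series_geom_scal; nra].
  intros k. unfold quadratic_term. cbn [moebius_coef moebius_centered_coef].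
  rewrite !Cmod_R, Rabs_Ropp, pow2_abs.
  rewrite !Rpow_mult_distr, <- !pow_mult, (Nat.mul_comm k 2). simpl. ring.
Qed.

Lemma bohr_series_converge_moebius :
  bohr_series_converge (moebius_coef x) (moebius_centered_coef x) r.
Proof.
  split; eexists; [apply is_series_linear_moebius|apply is_series_quadratic_moebius].
Qed.

Lemma bohr_sum_moebius c :
  bohr_sum c (moebius_coef x) (moebius_centered_coef x) r
  = x + 2 * (1 - x ^ 2) * r / (1 - x * r) + c * (2 * (1 - x ^ 2) ^ 2 * r / (1 - x ^ 2 * r)).
Proof.
  unfold bohr_sum.
  rewrite (is_series_unique _ _ is_series_linear_moebius), (is_series_unique _ _ is_series_quadratic_moebius).
  cbn [moebius_coef]. rewrite Cmod_R, Rabs_pos_eq; [reflexivity|lra].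
Qed.

End Extremal.

(** The excess of the sum over 1 has the sign of
[2 * c * (1 + x) ^ 2 * (5 - x) - 3 * (5 - x ^ 2)], which tends to [32 * c - 12 > 0]
as [x] tends to 1. *)
Lemma quadratic_coefficient_sharp (c : R) :
  3 / 8 < c ->
  exists x, 0 <= x < 1 /\ 1 < x + 2 * (1 - x ^ 2) * (1 / 5) / (1 - x * (1 / 5))
     + c * (2 * (1 - x ^ 2) ^ 2 * (1 / 5) / (1 - x ^ 2 * (1 / 5))).
Proof.
  (* With [x = 1 - e] the sign quantity is at least [32 * c - 12 - e * (32 * c + 6)];
     this [e] makes it half of [32 * c - 12]. *)
  intros Hc. set (e := (32 * c - 12) / (2 * (32 * c + 6))).
  assert (He : 0 < e < 1).
  { unfold e. split; [apply Rdiv_lt_0_compat; lra|].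
    apply Rmult_lt_reg_r with (2 * (32 * c + 6)); [lra|].
    unfold Rdiv. rewrite Rmult_assoc, Rinv_l; lra. }
  assert (E : 2 * e * (32 * c + 6) = 32 * c - 12) by (unfold e; field; lra).
  exists (1 - e). split; [lra|].
  set (x := 1 - e). assert (Hx : 0 < x < 1) by (unfold x; lra).
  assert (P : 0 < (5 - x) * (5 - x ^ 2)) by (apply Rmult_lt_0_compat; nra).
  apply Rlt_0_minus.
  replace (x + 2 * (1 - x ^ 2) * (1 / 5) / (1 - x * (1 / 5))
     + c * (2 * (1 - x ^ 2) ^ 2 * (1 / 5) / (1 - x ^ 2 * (1 / 5))) - 1)
    with ((1 - x) ^ 2 * (2 * c * (1 + x) ^ 2 * (5 - x) - 3 * (5 - x ^ 2)) / ((5 - x) * (5 - x ^ 2)))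
    by (field; split; nra).
  apply Rdiv_lt_0_compat; [|exact P].
  apply Rmult_lt_0_compat; [apply pow_lt; lra|].
  unfold x. nra.
Qed.

(** The linear part alone exceeds 1 as soon as [r * (2 + 3 * x) > 1]; as [x] tends to
1 this only requires [r > 1 / 5]. *)
Lemma radius_sharp (rho : R) :
  1 / 5 < rho ->
  exists x r, 0 <= x < 1 /\ 0 <= r < 1 /\ r <= rho /\
   1 < x + 2 * (1 - x ^ 2) * r / (1 - x * r)
     + 3 / 8 * (2 * (1 - x ^ 2) ^ 2 * r / (1 - x ^ 2 * r)).
Proof.
  intros Hrho. set (r := Rmin rho (1 / 2)).
  assert (Hr : 1 / 5 < r <= 1 / 2) by (split; [apply Rmin_glb_lt; lra|apply Rmin_r]).
  assert (Hr' : r <= rho) by apply Rmin_l.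
  (* The midpoint between 1 and the threshold [(1 / r - 2) / 3]; [r <= 1 / 2] keeps it nonnegative. *)
  set (x := (/ r - 2) / 6 + 1 / 2).
  assert (Exr : r * (6 * x - 1) = 1) by (unfold x; field; lra).
  assert (Hx : 0 <= x < 1) by (split; nra).
  exists x, r. repeat split; try lra.
  assert (P : 0 < 1 - x * r) by nra. assert (P' : 0 < 1 - x ^ 2 * r) by nra.
  apply Rlt_le_trans with (x + 2 * (1 - x ^ 2) * r / (1 - x * r)).
  - apply Rlt_0_minus.
    replace (x + 2 * (1 - x ^ 2) * r / (1 - x * r) - 1)
      with ((1 - x) * (r * (2 + 3 * x) - 1) / (1 - x * r)) by (field; lra).
    apply Rdiv_lt_0_compat; [|exact P]. apply Rmult_lt_0_compat; nra.
  - assert (0 <= 3 / 8 * (2 * (1 - x ^ 2) ^ 2 * r / (1 - x ^ 2 * r))); [|lra].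
    apply Rmult_le_pos; [lra|]. apply Rmult_le_pos; [|apply Rlt_le, Rinv_0_lt_compat, P'].
    apply Rmult_le_pos; [|lra]. apply Rmult_le_pos; [lra|apply pow2_ge_0].
Qed.

Theorem theorem2 :
  (forall (f h g : C -> C) (a b : nat -> C),
     harmonic_mapping f h g a b ->
     forall r : R, 0 <= r <= 1 / 5 ->
       bohr_series_converge a b r /\ bohr_sum (3 / 8) a b r <= 1)
  /\
  (forall c : R, 3 / 8 < c ->
     exists (f h g : C -> C) (a b : nat -> C) (r : R),
       harmonic_mapping f h g a b /\ 0 <= r <= 1 / 5 /\
       bohr_series_converge a b r /\ ~ (bohr_sum c a b r <= 1))
  /\
  (forall rho : R, 1 / 5 < rho ->
     exists (f h g : C -> C) (a b : nat -> C) (r : R),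
       harmonic_mapping f h g a b /\ 0 <= r < 1 /\ r <= rho /\
       bohr_series_converge a b r /\ ~ (bohr_sum (3 / 8) a b r <= 1)).
Proof.
  split; [|split].
  - intros f h g a b Hm r Hr. now apply (bohr_inequality f h g).
  - intros c Hc. destruct (quadratic_coefficient_sharp c Hc) as [x [Hx H]].
    exists (fun z => (moebius x z + Cconj (moebius_centered x z))%C), (moebius x), (moebius_centered x),
      (moebius_coef x), (moebius_centered_coef x), (1 / 5).
    assert (H5 : 0 <= 1 / 5 < 1) by lra.
    split; [now apply harmonic_mapping_moebius|]. split; [lra|].
    split; [now apply bohr_series_converge_moebius|].
    rewrite bohr_sum_moebius by assumption. now apply Rlt_not_le.
  - intros rho Hrho. destruct (radius_sharp rho Hrho) as [x [r [Hx [Hr [Hle H]]]]].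
    exists (fun z => (moebius x z + Cconj (moebius_centered x z))%C), (moebius x), (moebius_centered x),
      (moebius_coef x), (moebius_centered_coef x), r.
    split; [now apply harmonic_mapping_moebius|]. split; [exact Hr|]. split; [exact Hle|].
    split; [now apply bohr_series_converge_moebius|].
    rewrite bohr_sum_moebius by assumption. now apply Rlt_not_le.
Qed.
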